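(* Let $X$ be a complete separable metric space, $\mu$ a Radon measure on $X$ and $f\colon X\to\mathbb R^q$ Lipschitz. Suppose that $\mathcal A=(P,\nu)$ is a Lipschitz Alberti representation of $\mu$ in the $f$-direction of the cone field $\mathcal C(v,\alpha)$, where $v\colon X\to\mathbb S^{q-1}$ and $\alpha\colon X\to(0,\pi/2)$ are Borel. Then $$D_{\mathcal A}f(x)\in\mathcal C(v(x),\alpha(x))\quad\text{for }\mu\text{-a.e. }x.$$ In particular, if the Lipschitz Alberti representations $\{\mathcal A_i\}_{i=1}^k$ of $\mu$ are in the $f$-directions of independent cone fields $\{\mathcal C(v_i,\alpha_i)\}_{i=1}^k$, then the derivations $\{D_{\mathcal A_i}\}_{i=1}^k$ are (linearly) independent over $L^\infty(\mu)$.
   Context: Cones: $\mathcal C(w,\theta)=\{u\in\mathbb R^q:\tan\theta\,\langle w,u\rangle>\|\pi_w^\perp u\|_2\}$ for $w\in\mathbb S^{q-1}$, $\theta\in(0,\pi/2)$, $\pi_w^\perp$ being the orthogonal projection onto the orthogonal complement of $w$. A cone field is a Borel assignment $x\mapsto\mathcal C(v(x),\alpha(x))$. Cone fields $\mathcal C_1,\dots,\mathcal C_k$ are independent if for each $x\in X$ and any choice of $u_i\in\mathcal C_i(x)\setminus\{0\}$ the vectors $u_1,\dots,u_k$ are linearly independent. Derivations: $\operatorname{Lip}_b(X)$ is the algebra of bounded real Lipschitz functions with norm $\max(\|f\|_\infty,\mathbf L(f))$, $\mathbf L(f)$ being the global Lipschitz constant; it is a dual Banach space, and $f_n\to f$ weak*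 iff $f_n\to f$ pointwise and the $f_n$ are bounded in norm. A derivation is a bounded linear map $D\colon\operatorname{Lip}_b(X)\to L^\infty(\mu)$ with $D(fg)=fDg+gDf$ that is weak* continuous (if $f_n\to f$ weak* then $\int h\,Df_n\,d\mu\to\int h\,Df\,d\mu$ for all $h\in L^1(\mu)$). Derivations form an $L^\infty(\mu)$-module $\mathscr X(\mu)$. Derivations are local ($f=g$ on $U$ implies $\chi_UDf=\chi_UDg$), and extend to all real Lipschitz $f$ by requiring $\chi_KDf=\chi_KDh$ whenever $K$ is compact and $h\in\operatorname{Lip}_b(X)$ agrees with $f$ on $K$; for $f=(f_1,\dots,f_q)$, $Df=(Df_1,\dots,Df_q)$. Fragments: a fragment in $X$ is a bi-Lipschitz map $\gamma\colon K\to X$ with $K=\operatorname{dom}\gamma\subset\mathbb R$ compact of positive Lebesgue measure; $\operatorname{Frag}(X)$ is the set of fragments, topologized by identifying $\gamma$ with its graph in the space of nonempty compact subsets of $\mathbb R\times X$ with the Hausdorff distance. For $f$ Lipschitz $(f\circ\gamma)'(t)$ is computed along $\operatorname{dom}\gamma$ (it exists for a.e. $t$). Alberti representations: an Alberti representation of $\mu$ is a pair $\mathcal A=(P,\nu)$ where (1) $P$ is a regular Borel probability measure on $\operatorname{Frag}(X)$; (2) $\gamma\mapsto\nu_\gamma$ assigns to each fragment a finite nonnegative Borel measure on $X$, absolutely continuous with respect to the 1-dimensional Hausdorff measure on the image of $\gamma$, and $\gamma\mapsto\int g\,d\nu_\gamma$ is Borel for each $g\in C_c(X)$; (3) $\mu(A)=\int\nu_\gamma(A)\,dP(\gamma)$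 for all Borel $A$; (4) for all Borel $A\subset X$ and reals $a\le b$, $\gamma\mapsto\nu_\gamma(A\cap\gamma(\operatorname{dom}\gamma\cap[a,b]))$ is Borel. It is Lipschitz if for some $C$ $P$-a.e. $\gamma$ is $C$-Lipschitz. It is in the $f$-direction of $\mathcal C(v,\alpha)$ if for $P$-a.e. $\gamma$ and a.e. $t\in\operatorname{dom}\gamma$, $(f\circ\gamma)'(t)\in\mathcal C(v(\gamma(t)),\alpha(\gamma(t)))$. To a Lipschitz Alberti representation one associates the derivation $D_{\mathcal A}\in\mathscr X(\mu)$ given by $\int gD_{\mathcal A}f\,d\mu=\int dP(\gamma)\int_X g\,\partial_\gamma f\,d\nu_\gamma$ for bounded Borel $g\in L^1(\mu)$ and $f\in\operatorname{Lip}_b(X)$, where $\partial_\gamma f(x)=(f\circ\gamma)'(\gamma^{-1}(x))$ if $x$ is in the image of $\gamma$ and the derivative exists, and $0$ otherwise. *)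

(* Defs.v *)
From HB Require Import structures.
From mathcomp Require Import all_boot all_order all_algebra.
From mathcomp Require Import all_classical all_reals all_analysis.
From mathcomp Require Import measurable_realfun.

Set Implicit Arguments.
Unset Strict Implicit.
Unset Printing Implicit Defensive.

Import Order.TTheory GRing.Theory Num.Theory.
Import numFieldNormedType.Exports.

Local Open Scope classical_set_scope.
Local Open Scope ring_scope.

(* Complete types are pointed in the library, hence nonempty; nothing is lost
   below, as the empty space carries no fragment and no Alberti representation. *)
#[short(type="completeMetricType")]
HB.structure Definition CompleteMetric (K : numDomainType) :=
  { T of Complete T & Metric K T }.

Definition separable (T : topologicalType) :=
  exists2 D : set T, countable D & dense D.

Definition borel (T : ptopologicalType) := g_sigma_algebraType (@open T).

Section regularity.
Context (R : realType) (T : ptopologicalType).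
Implicit Type m : {measure set (borel T) -> \bar R}.

Definition inner_regular m := forall A : set (borel T), measurable A ->
  m A = ereal_sup [set m K | K in [set K : set T | compact K /\ K `<=` A]].

Definition outer_regular m := forall A : set (borel T), measurable A ->
  m A = ereal_inf [set m U | U in [set U : set T | open U /\ A `<=` U]].

Definition locally_finite m :=
  forall x : T, exists2 U : set T, open_nbhs x U & (m U < +oo)%E.

(* On a separable metric space such measures are also outer regular. *)
Definition radon m := locally_finite m /\ inner_regular m.

End regularity.

Section cones.
Context (R : realType) (q : nat).
Implicit Types u w : 'rV[R]_q.

Definition dot u w : R := \sum_(j < q) u 0 j * w 0 j.

(* The library norm on 'rV[R]_q is the sup norm. *)
Definition enorm u : R := Num.sqrt (dot u u).

Definition orth_proj w u := u - dot w u *: w.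

Definition cone w (theta : R) : set 'rV[R]_q :=
  [set u | enorm (orth_proj w u) < tan theta * dot w u].

End cones.

Section cone_fields.
Context (R : realType) (X : completeMetricType R) (q : nat).

Record cone_field := ConeField {
  axis : X -> 'rV[R]_q ;
  angle : X -> R ;
  axis_unit : forall x, enorm (axis x) = 1 ;
  angle_bounds : forall x, 0 < angle x < pi / 2 ;
  axis_borel : measurable_fun setT (axis : borel X -> borel 'rV[R]_q) ;
  angle_borel : measurable_fun setT (angle : borel X -> R) }.

Definition cone_at (C : cone_field) (x : X) : set 'rV[R]_q :=
  cone (axis C x) (angle C x).

Definition independent_cone_fields k (C : 'I_k -> cone_field) :=
  forall (x : X) (u : 'I_k -> 'rV[R]_q),
    (forall i, cone_at (C i) x (u i) /\ u i != 0) ->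
    free [tuple u i | i < k].

Definition lipschitz_vec (f : X -> 'rV[R]_q) :=
  exists L : R, forall x y, enorm (f x - f y) <= L * mdist x y.

End cone_fields.

Section lipschitz_functions.
Context (R : realType) (X : completeMetricType R).
Implicit Type f : X -> R.

Definition lipschitz_fun f :=
  exists L : R, forall x y, `|f x - f y| <= L * mdist x y.

Definition lipb f := (exists M : R, forall x, `|f x| <= M) /\ lipschitz_fun f.

(* Junk unless f is Lipschitz. *)
Definition lip_const f : R :=
  sup [set r | exists x y, x != y /\ r = `|f x - f y| / mdist x y].

Definition sup_norm f : R := sup [set `|f x| | x in setT].

Definition lipb_norm f : R := Num.max (sup_norm f) (lip_const f).

Definition weakstar_cvg (fn : nat -> X -> R) f :=
  (exists M : R, forall n, lipb_norm (fn n) <= M) /\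
  (forall x, fn n x @[n --> \oo] --> f x).

End lipschitz_functions.

Section derivations.
Context (R : realType) (X : completeMetricType R).
Context (mu : {measure set (borel X) -> \bar R}).

(* Representatives of elements of L^oo(mu): equality in L^oo(mu) is
   equality mu-almost everywhere. *)
Definition Linfty := LfunType mu (leey 1).

(* Only the values of a derivation on bounded Lipschitz functions matter. *)
Record derivation := Derivation {
  der :> (X -> R) -> Linfty ;
  der_linear : forall (a : R) (f g : X -> R), lipb f -> lipb g ->
    der (fun x => a * f x + g x) =
    (fun x => a * der f x + der g x) %[ae mu] ;
  der_bounded : exists C : R, forall f : X -> R, lipb f ->
    ('N[mu]_+oo[EFin \o der f] <= (C * lipb_norm f)%:E)%E ;
  der_leibniz : forall f g : X -> R, lipb f -> lipb g ->
    der (fun x => f x * g x) =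
    (fun x => f x * der g x + g x * der f x) %[ae mu] ;
  der_weakstar : forall (fn : nat -> X -> R) (f : X -> R),
    (forall n, lipb (fn n)) -> lipb f -> weakstar_cvg fn f ->
    forall h : borel X -> R, mu.-integrable setT (EFin \o h) ->
    (\int[mu]_x (h x * der (fn n) x))%R @[n --> \oo] -->
    (\int[mu]_x (h x * der f x))%R }.

(* g is (a version of) the value at the Lipschitz function f, possibly
   unbounded, of the extension of D; as mu is Radon, it is unique mu-a.e. *)
Definition extended_value (D : derivation) (f : X -> R) (g : borel X -> R) :=
  measurable_fun setT g /\
  forall (K : set X) (h : X -> R), compact K -> lipb h ->
    (forall x, K x -> h x = f x) -> g = D h %[ae mu in K].

Definition extended_value_vec q (D : derivation) (f : X -> 'rV[R]_q)
    (g : X -> 'rV[R]_q) :=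
  forall j, extended_value D (fun x => f x 0 j) (fun x => g x 0 j).

Definition independent_derivations k (D : 'I_k -> derivation) :=
  forall lam : 'I_k -> Linfty,
    (forall f : X -> R, lipb f ->
      (fun x => \sum_(i < k) lam i x * D i f x) = (fun=> 0) %[ae mu]) ->
    forall i, (lam i : borel X -> R) = (fun=> 0) %[ae mu].

End derivations.

Section fragments.
Context (R : realType) (X : completeMetricType R).

(* frag_out is a normalization: a fragment is determined by its graph over
   its domain, so the values of frag_map elsewhere are set to a fixed one. *)
Record fragment := Fragment {
  dom : set R ;
  frag_map :> R -> X ;
  dom_compact : compact dom ;
  dom_gt0 : (0 < lebesgue_measure dom)%E ;
  frag_bilip : exists c C : R, 0 < c /\ forall s t, dom s -> dom t ->
    c * `|s - t| <= mdist (frag_map s) (frag_map t) <= C * `|s - t| ;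
  frag_out : forall t, ~ dom t -> frag_map t = point }.

HB.instance Definition _ := gen_eqMixin fragment.
HB.instance Definition _ := gen_choiceMixin fragment.

Implicit Type gam : fragment.

Definition frag_image gam : set X := gam @` dom gam.

Definition graph gam : set (R * X) := (fun t => (t, gam t)) @` dom gam.

Definition frag_lipschitz (C : R) gam := forall s t, dom gam s -> dom gam t ->
  mdist (gam s) (gam t) <= C * `|s - t|.

(* R * X carries the max of the two distances. *)
Definition hausdorff_radii (M : pseudoMetricType R) (A B : set M) : set R :=
  [set e : R | [/\ 0 < e, A `<=` \bigcup_(b in B) ball b e &
                          B `<=` \bigcup_(a in A) ball a e]].

Definition hausdorff_dist (M : pseudoMetricType R) (A B : set M) : R :=
  inf (hausdorff_radii A B).

Definition frag_dist gam1 gam2 : R := hausdorff_dist (graph gam1) (graph gam2).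

Let radii_lb (A B : set (R * X)) : lbound (hausdorff_radii A B) 0.
Proof. by move=> e [/ltW]. Qed.

Let radii_has_lb (A B : set (R * X)) : has_lbound (hausdorff_radii A B).
Proof. by exists 0; exact: radii_lb. Qed.

Let dom_nonempty gam : exists t, dom gam t.
Proof.
apply/set0P/eqP => d0; have := dom_gt0 gam.
by rewrite d0 measure0 ltxx.
Qed.

Let graphs_near gam1 gam2 : exists2 E : R, 0 < E &
  forall p1 p2, graph gam1 p1 -> graph gam2 p2 -> ball p1 E p2.
Proof.
have [s0 ds0] := dom_nonempty gam1; have [t0 dt0] := dom_nonempty gam2.
have [M1 [_ /(_ (M1 + 1))]] := compact_bounded (@dom_compact gam1).
rewrite ltrDl ltr01 => /(_ isT) B1.
have [M2 [_ /(_ (M2 + 1))]] := compact_bounded (@dom_compact gam2).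
rewrite ltrDl ltr01 => /(_ isT) B2.
have [c1 [C1 [_ L1]]] := frag_bilip gam1.
have [c2 [C2 [_ L2]]] := frag_bilip gam2.
pose N1 := `|M1| + 1; pose N2 := `|M2| + 1.
have b1 s : dom gam1 s -> `|s| <= N1.
  by move=> /B1/= /le_trans; apply; rewrite lerD2r ler_norm.
have b2 s : dom gam2 s -> `|s| <= N2.
  by move=> /B2/= /le_trans; apply; rewrite lerD2r ler_norm.
have N10 : 0 <= N1 by rewrite addr_ge0.
have N20 : 0 <= N2 by rewrite addr_ge0.
pose E1 := `|C1| * (N1 + N1); pose E2 := `|C2| * (N2 + N2).
have E10 : 0 <= E1 by rewrite mulr_ge0// addr_ge0.
have E20 : 0 <= E2 by rewrite mulr_ge0// addr_ge0.
have d00 : 0 <= mdist (gam1 s0) (gam2 t0) by exact: mdist_ge0.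
exists (N1 + N2 + (E1 + mdist (gam1 s0) (gam2 t0) + E2) + 1).
  by rewrite ltr_wpDl// !addr_ge0.
move=> _ _ [s ds <-] [t dt <-]; split => /=.
  rewrite /ball/= (le_lt_trans (ler_normB _ _))//.
  rewrite -addrA ltr_pwDr ?lerD ?b1 ?b2//.
  by rewrite ltr_wpDl// !addr_ge0.
rewrite ballEmdist/=.
have h1 : mdist (gam1 s) (gam1 s0) <= E1.
  have /andP[_ /le_trans] := L1 _ _ ds ds0; apply.
  apply: (le_trans (ler_wpM2r _ (ler_norm _))) => //; apply: ler_wpM2l => //.
  by rewrite (le_trans (ler_normB _ _))// lerD// b1.
have h2 : mdist (gam2 t0) (gam2 t) <= E2.
  have /andP[_ /le_trans] := L2 _ _ dt0 dt; apply.
  apply: (le_trans (ler_wpM2r _ (ler_norm _))) => //; apply: ler_wpM2l => //.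
  by rewrite (le_trans (ler_normB _ _))// lerD// b2.
rewrite (@le_lt_trans _ _ (E1 + mdist (gam1 s0) (gam2 t0) + E2))//.
  rewrite (le_trans (metric_triangle _ (gam2 t0) _))// lerD//.
  by rewrite (le_trans (metric_triangle _ (gam1 s0) _))// lerD.
by rewrite ltr_pwDr// lerDr addr_ge0.
Qed.

Let radii_nonempty gam1 gam2 :
  hausdorff_radii (graph gam1) (graph gam2) !=set0.
Proof.
have [E E0 h] := graphs_near gam1 gam2; exists E; split => //.
- move=> p gp; have [t dt] := dom_nonempty gam2.
  exists (t, gam2 t); first by exists t.
  by apply: ball_sym; apply: h => //; exists t.
- move=> p gp; have [t dt] := dom_nonempty gam1.
  exists (t, gam1 t); first by exists t.
  by apply: h => //; exists t.
Qed.

Let frag_distxx gam : frag_dist gam gam = 0.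
Proof.
apply/eqP; rewrite eq_le; apply/andP; split; last first.
  by apply: lb_le_inf; [exact: radii_nonempty|exact: radii_lb].
apply/ler_addgt0Pr => e e0; rewrite add0r.
by apply: ge_inf; [exact: radii_has_lb|split => // p gp; exists p => //;
  exact: ball_center (PosNum e0)].
Qed.

Let frag_dist_sym gam1 gam2 : frag_dist gam1 gam2 = frag_dist gam2 gam1.
Proof.
by congr inf; apply/seteqP; split => e /= [? ? ?].
Qed.

Let frag_dist_triangle gam2 gam1 gam3 :
  frag_dist gam1 gam3 <= frag_dist gam1 gam2 + frag_dist gam2 gam3.
Proof.
rewrite -lerBlDr; apply: lb_le_inf; first exact: radii_nonempty.
move=> e1 [e10 s12 s21]; rewrite lerBlDr -lerBlDl.
apply: lb_le_inf; first exact: radii_nonempty.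
move=> e2 [e20 s23 s32]; rewrite lerBlDl.
apply: ge_inf; first exact: radii_has_lb.
split; first exact: addr_gt0.
- move=> p /s12[r /s23[u gu bu] br]; exists u => //.
  by rewrite addrC; exact: ball_triangle bu br.
- move=> p /s32[r /s21[u gu bu] br]; exists u => //.
  exact: ball_triangle bu br.
Qed.

Let frag_dist0_sub gam1 gam2 t : frag_dist gam1 gam2 = 0 ->
  dom gam1 t -> dom gam2 t /\ gam1 t = gam2 t.
Proof.
move=> d0 dt.
have near e : 0 < e -> exists s, [/\ dom gam2 s, `|s - t| < e &
    mdist (gam2 s) (gam1 t) < e].
  move=> e0.
  have [e' [e'0 + _]] := inf_adherent e0
    (conj (radii_nonempty gam1 gam2) (radii_has_lb _ _)).
  rewrite -[inf _]/(frag_dist gam1 gam2) d0 add0r => /(_ (t, gam1 t)) + e'e.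
  case; first by exists t.
  move=> _ [s ds <-] [/= b1 b2]; exists s; split => //.
    exact: lt_trans e'e.
  by move: b2; rewrite ballEmdist/= => /lt_trans; apply.
have d2t : dom gam2 t.
  have /closure_id -> : closed (dom gam2).
    by apply: compact_closed; [exact: norm_hausdorff|exact: dom_compact].
  move=> B /nbhs_ballP[e /= e0 eB].
  have [s [ds st _]] := near _ e0; exists s; split => //.
  by apply: eB; rewrite /ball/= distrC.
split => //.
apply: mdist_positivity; apply/eqP; rewrite eq_le mdist_ge0 andbT.
have [c [C [_ L]]] := frag_bilip gam2.
have C0 : 0 < `|C| + 1 by rewrite ltr_wpDl.
apply/ler_addgt0Pr => e e0; rewrite add0r.
have e'0 : 0 < e / (`|C| + 1 + 1) by rewrite divr_gt0// addr_gt0.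
have [s [ds st sm]] := near _ e'0.
rewrite (le_trans (metric_triangle _ (gam2 s) _))//.
rewrite (@le_trans _ _ (e / (`|C| + 1 + 1) + (`|C| + 1) * (e / (`|C| + 1 + 1))))//.
  apply: lerD; first by rewrite metric_sym ltW.
  have /andP[_ /le_trans] := L _ _ ds d2t; apply.
  apply: (@le_trans _ _ ((`|C| + 1) * `|s - t|)).
    by apply: ler_wpM2r => //; rewrite (le_trans (ler_norm _))// lerDl.
  by apply: ler_wpM2l; exact: ltW.
by rewrite -{1}[e / _]mul1r -mulrDl mulrCA [1 + _]addrC divff ?mulr1// gt_eqF// addr_gt0.
Qed.

Let frag_dist_positivity gam1 gam2 : frag_dist gam1 gam2 = 0 -> gam1 = gam2.
Proof.
move=> d0; have d0' : frag_dist gam2 gam1 = 0 by rewrite frag_dist_sym.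
have ed : dom gam1 = dom gam2.
  by apply/seteqP; split => t dt; [have [] := frag_dist0_sub d0 dt
                                  |have [] := frag_dist0_sub d0' dt].
have em : gam1 = gam2 :> (R -> X).
  apply/funext => t; have [dt|dt] := pselect (dom gam1 t).
    by have [] := frag_dist0_sub d0 dt.
  by rewrite (frag_out dt) frag_out// -ed.
case: gam1 gam2 ed em {d0 d0'} => d1 m1 ? ? ? ? [d2 m2 ? ? ? ?] /= ed em.
by subst d2 m2; congr Fragment; exact: Prop_irrelevance.
Qed.

HB.instance Definition _ := isMetric.Build R fragment
  frag_distxx frag_dist_positivity frag_dist_sym frag_dist_triangle.

(* Measurable types are pointed in the library; frag_at gam0 is Frag(X) with the
   fragment gam0 as distinguished point, which has no other role. *)
Definition frag_at (gam0 : fragment) : Type := fragment.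

HB.instance Definition _ gam0 := Metric.on (frag_at gam0).
HB.instance Definition _ gam0 := isPointed.Build (frag_at gam0) gam0.

End fragments.

Section fragment_derivatives.
Context (R : realType) (X : completeMetricType R).

(* l = (f o gam)'(t), the limit being taken along the domain of gam. *)
Definition is_deriv_along (gam : fragment X) (f : X -> R) (t l : R) :=
  [/\ dom gam t, limit_point (dom gam) t &
      (f (gam s) - f (gam t)) / (s - t) @[s --> within (dom gam) t^'] --> l].

(* (f o gam)'(gam^-1 x) if it makes sense and 0 otherwise; t and l are unique. *)
Definition frag_partial (gam : fragment X) (f : X -> R) (x : X) : R :=
  xget 0 [set l | exists2 t, gam t = x & is_deriv_along gam f t l].

End fragment_derivatives.

Section hausdorff_measure.
Context (R : realType) (X : completeMetricType R).
Local Open Scope ereal_scope.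

Definition diam (E : set X) : \bar R :=
  ereal_sup (0 |` [set (mdist p.1 p.2)%:E | p in E `*` E]).

Definition hausdorff1_pre (delta : R) (A : set X) : \bar R :=
  ereal_inf [set \sum_(0 <= n <oo) diam (E n) | E in
    [set E : (set X)^nat | A `<=` \bigcup_n E n /\
                           forall n, diam (E n) <= delta%:E]].

Definition hausdorff1 (A : set X) : \bar R :=
  ereal_sup [set hausdorff1_pre delta A | delta in [set delta : R | (0 < delta)%R]].

End hausdorff_measure.

Section alberti.
Context (R : realType) (X : completeMetricType R).
Context (mu : {measure set (borel X) -> \bar R}).

Record alberti := Alberti {
  alb_pt : fragment X ;
  alb_P : probability (borel (frag_at alb_pt)) R ;
  alb_nu : fragment X -> {finite_measure set (borel X) -> \bar R} ;
  alb_P_regular : inner_regular alb_P /\ outer_regular alb_P ;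
  alb_nu_ac : forall (gam : fragment X) (A : set (borel X)), measurable A ->
    hausdorff1 (A `&` frag_image gam) = 0%E -> alb_nu gam A = 0%E ;
  alb_nu_borel : forall g : X -> R, continuous g ->
    compact (closure [set x | g x != 0]) ->
    measurable_fun setT (fun gam : borel (frag_at alb_pt) =>
      \int[alb_nu gam]_x (g x)%:E)%E ;
  alb_mu : forall A : set (borel X), measurable A ->
    mu A = (\int[alb_P]_gam alb_nu gam A)%E ;
  alb_arc_borel : forall (A : set (borel X)) (a b : R), measurable A -> a <= b ->
    measurable_fun setT (fun gam : borel (frag_at alb_pt) =>
      alb_nu gam (A `&` frag_map gam @` (dom gam `&` `[a, b]))) }.

Definition alberti_lipschitz (A : alberti) :=
  exists C : R, {ae alb_P A, forall gam, frag_lipschitz C gam}.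

Definition in_direction q (A : alberti) (f : X -> 'rV[R]_q)
    (C : cone_field X q) :=
  {ae alb_P A, forall gam : fragment X,
    {ae lebesgue_measure, forall t : R, dom gam t ->
      exists2 u : 'rV[R]_q,
        forall j, is_deriv_along gam (fun x => f x 0 j) t (u 0 j) &
        cone_at C (gam t) u}}.

(* D is the derivation associated with A; it is unique mu-a.e. *)
Definition associated_derivation (A : alberti) (D : derivation mu) :=
  forall (g : borel X -> R) (f : X -> R),
    measurable_fun setT g -> (exists M : R, forall x, `|g x| <= M) ->
    mu.-integrable setT (EFin \o g) -> lipb f ->
    (\int[mu]_x (g x * D f x)%:E =
     \int[alb_P A]_gam \int[alb_nu A gam]_x (g x * frag_partial gam f x)%:E)%E.

End alberti.

(* Main.v *)
Require Import Defs.
From HB Require Import structures.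
From mathcomp Require Import all_boot all_order all_algebra.
From mathcomp Require Import all_classical all_reals all_analysis.
From mathcomp Require Import measurable_realfun.
From mathcomp Require Import lra.

Set Implicit Arguments.
Unset Strict Implicit.
Unset Printing Implicit Defensive.

Import Order.TTheory GRing.Theory Num.Theory.
Import numFieldNormedType.Exports.

Local Open Scope classical_set_scope.
Local Open Scope ring_scope.

(** Averages of vectors lying in an open convex cone stay in that cone, and
    D_A f(x) is such an average of velocities (f o gam)'(t), gam t = x.  Instead
    of disintegrating P and nu over mu, the averaging argument is run in dual
    form.  The cone C(v, theta) is the set of u on which all its
    inner normals are positive, and the normal cone_normal v theta u attached
    to u itself already decides whether u is in the cone (cone_normalP).
    Suppose the value Dh of the derivation fails the cone condition on a
    compact set K, and let a(x) be the normal attached to Dh(x), so that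
    <a, Dh> <= 0 on K.  The defining formula of D_A, applied to each coordinate
    with the weight 1_K a_j and summed over j, gives
      0 >= int_K <a, Dh> dmu = int dP(gam) int_K <a, (f o gam)'> dnu_gam .
    By the direction hypothesis the inner integrand is positive nu_gam-almost
    everywhere on K; hence nu_gam(K) = 0 for almost every gam, and mu(K) = 0
    (null_compact_of_normal_le0).  Inner regularity concludes
    (derivation_in_cone).  The normal must vary with x: when Dh(x) is a
    nonzero boundary point of the cone there is only one normal up to scaling,
    so no countable family of fixed normals detects it.

    Summing over j is legitimate only for measurable integrands: the integral
    of an arbitrary function is a difference of lower integrals, which is not
    additive.  The derivative of F along gam at gam^-1 x is therefore replaced
    by a function frag_deriv of the pair (gam, x), measurable for the product
    of the Borel sigma-algebras, which agrees with it wherever it exists and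
    obeys a given bound (frag_derivE).  It is built from the sets of pairs at
    which some difference quotient over a controlled scale is at most a; these
    are countable unions of closed sets because fragments have compact graphs
    (closed_frag_hits).  The two functions agree outside null sets only, which
    is enough, as lower integrals ignore null sets (ae_integral_nonmeasurable);
    that Lebesgue-null sets of times are nu_gam-null comes from the absolute
    continuity of nu_gam with respect to the Hausdorff measure
    (frag_null_image, alb_nu_ae).

    The coordinates of f may be unbounded, so they are first replaced on each
    ball by truncations (local_truncation).  For independence, a relation
    sum_i lam_i D_i = 0 evaluated at these truncations is a linear relation
    between the vectors D_i f(x), which lie in independent cones. *)

(** * Fragments and the Hausdorff distance *)

Section frag_topology.
Context (R : realType) (X : completeMetricType R).

Lemma frag_continuous (gam : fragment X) : {within dom gam, continuous gam}.
Proof.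
have [c [C [c0 bl]]] := frag_bilip gam.
apply/subspace_continuousP => t dt.
apply/metricType_numDomainType.cvgrPdist_lt => e e0.
have C1 : 0 < `|C| + 1 by rewrite ltr_wpDl.
have e'0 : 0 < e / (`|C| + 1) by rewrite divr_gt0.
near=> s.
have ds : dom gam s by near: s; exact: withinT.
have st : `|t - s| < e / (`|C| + 1).
  by near: s; apply: cvg_within; exact: (nbhsx_ballx t _ e'0).
have /andP[_ /le_lt_trans] := bl _ _ dt ds; apply.
apply: (@le_lt_trans _ _ ((`|C| + 1) * `|t - s|)).
  by apply: ler_wpM2r => //; rewrite (le_trans (ler_norm _))// lerDl.
by rewrite mulrC -ltr_pdivlMr.
Unshelve. all: by end_near. Qed.

Lemma compact_graph (gam : fragment X) : compact (graph gam).
Proof.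
apply: continuous_compact; last exact: dom_compact.
apply/subspace_continuousP => t dt.
apply: (@cvg_pair _ _ _ _ (nbhs t) (nbhs (gam t))); first exact: cvg_within.
by have /subspace_continuousP := @frag_continuous gam; exact.
Qed.

Lemma compact_arc (gam : fragment X) (a b : R) :
  compact (frag_map gam @` (dom gam `&` `[a, b])).
Proof.
apply: continuous_compact.
  by apply: continuous_subspaceW (@frag_continuous gam); exact: subIsetl.
rewrite setIC; apply: compact_closedI; last first.
  by apply: compact_closed; [exact: Rhausdorff|exact: dom_compact].
exact: segment_compact.
Qed.

Lemma frag_ball_graph (gam0 gam : fragment X) (e : R) :
  ball gam0 e gam -> forall p, graph gam p ->
  exists2 p0, graph gam0 p0 & ball p0 e p.
Proof.
rewrite ballEmdist/= => ge p gp.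
have [r0|r0] := eqVneq (hausdorff_radii (graph gam0) (graph gam)) set0.
  (* In this case the distance has the junk value inf set0 = 0, which forces
     the two fragments to be equal. *)
  have d0 : mdist gam0 gam = 0.
    by rewrite -[mdist _ _]/(inf (hausdorff_radii _ _)) r0 inf0.
  rewrite d0 in ge; rewrite (mdist_positivity _ _ d0); exists p => //.
  exact: ball_center (PosNum ge).
have /set0P/inf_lt/(_ ge)[e' [_ _ /(_ _ gp)[p0 g0 b0]] e'e] := r0.
by exists p0 => //; apply: le_ball b0; exact: ltW.
Qed.

(** The source of all measurability in the variable gam.  If the compact set
    graph gam0 x graph gam0 x {x0} misses Z, it has a uniform neighbourhood
    missing Z, which contains graph gam x graph gam x {x} for (gam, x) close to
    (gam0, x0).  Two points of the graph are needed to express difference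
    quotients. *)
Lemma closed_frag_hits (Z : set ((R * X) * (R * X) * X)) : closed Z ->
  closed [set u : fragment X * X | exists p r,
    [/\ graph u.1 p, graph u.1 r & Z (p, r, u.2)]].
Proof.
move=> clZ; rewrite -openC openE => -[gam0 x0] /= nH.
have : \forall e \near (0:R)^'+, graph gam0 `*` graph gam0 `<=`
    [set pr | ball (pr, x0) e `<=` ~` Z].
  have /compact_near_coveringP :=
    compact_setX (@compact_graph gam0) (@compact_graph gam0).
  apply => -[p r] [/= gp gr].
  have /nbhs_ballP[d /= d0 dZ] : nbhs (p, r, x0) (~` Z).
    apply: open_nbhs_nbhs; split; first by rewrite openC.
    by move=> Zp; apply: nH; exists p, r.
  have d20 : 0 < d / 2 by rewrite divr_gt0.
  exists (ball (p, r) (d / 2), [set e | e < d / 2]) => /=.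
    by split; [exact: nbhsx_ballx|exact: nbhs_right_lt].
  move=> [pr e] /= [b ed] z bz; apply: dZ; rewrite (splitr d).
  apply: (@ball_triangle _ _ (pr, x0)); last exact: le_ball (ltW ed) _ bz.
  by split => //; exact: ballxx.
move=> /(@filterI _ _ _ _ _ (nbhs_right_gt 0))/filter_ex[e /= [e0 he]].
apply/nbhs_ballP; exists e => // -[gam x] [/= bg bx] [p [r [gp gr]]] /=.
have [p0 gp0 bp] := frag_ball_graph bg gp.
have [r0 gr0 br] := frag_ball_graph bg gr.
by apply: (he (p0, r0)).
Qed.

Lemma metric_ball_open (x : X) e : open (ball x e).
Proof.
rewrite openE => y; rewrite ballEmdist/= => xy; apply/nbhs_ballP.
exists (e - mdist x y) => /=; first by rewrite subr_gt0.
move=> z; rewrite !ballEmdist/= ltrBrDl; apply: le_lt_trans.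
exact: metric_triangle.
Qed.

Lemma separable_seq : separable X ->
  exists s : nat -> X, forall x e, 0 < e -> exists n, ball x e (s n).
Proof.
move=> [D /countable_injP[f injf] dD].
exists (fun n => xget point [set d | D d /\ f d = n]) => x e e0.
have [d [Dd xd]] : D `&` ball x e !=set0.
  rewrite setIC; apply: dD; last exact: metric_ball_open.
  by exists x; exact: (ball_center x (PosNum e0)).
exists (f d).
have [Dy fy] := @xgetPex _ point [set d' | D d' /\ f d' = f d]
  (ex_intro _ d (conj Dd erefl)).
by rewrite (injf _ _ _ _ fy) ?inE.
Qed.

(** Opens of a product are in the product of the Borel sigma-algebras as soon
    as one factor is second countable: W is the union, over the countable base
    B k n of X, of the rectangles V k n x B k n with V k n the largest open set
    such that the rectangle is in W. *)
Lemma open_frag_prod_measurable (gam0 : fragment X) (W : set (fragment X * X)) :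
  separable X -> open W ->
  measurable (W : set (borel (frag_at gam0) * borel X)%type).
Proof.
move=> /separable_seq[s sP] oW.
pose B (k n : nat) : set X := ball (s k) (n.+1%:R^-1 : R).
pose V k n : set (fragment X) := [set g | forall x, B k n x -> W (g, x)]^°.
have -> : W = \bigcup_k \bigcup_n (V k n `*` B k n).
  apply/seteqP; split => [[g x] Wgx|[g x] [k _ [n _ [/= Vg Bx]]]]; last first.
    by apply: (interior_subset Vg); exact: Bx.
  have /nbhs_ballP[e /= e0 eW] := open_nbhs_nbhs (conj oW Wgx).
  have e20 : 0 < e / 2 by rewrite divr_gt0.
  have [n nP] : exists n, n.+1%:R^-1 < e / 2.
    have [n _ /(_ n)/= h] := near_infty_natSinv_lt (PosNum e20).
    by exists n; apply: h => /=.
  have n0 : 0 < n.+1%:R^-1 :> R by rewrite invr_gt0.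
  have [k kP] := sP x _ n0.
  exists k => //; exists n => //; split => /=; last first.
    exact: ball_sym.
  apply/nbhs_ballP; exists (e / 2) => // g' bg' x' Bx'.
  apply: eW; split => /=.
    by apply: le_ball bg'; rewrite ler_pdivrMr// ler_pMr// ler1n.
  rewrite (splitr e); apply: (ball_triangle (le_ball (ltW nP) kP)).
  exact: le_ball (ltW nP) _ Bx'.
apply: bigcupT_measurable => k; apply: bigcupT_measurable => n.
apply: measurableX; apply: sub_sigma_algebra;
  [exact: open_interior|exact: metric_ball_open].
Qed.

End frag_topology.

(** * Derivatives along fragments *)

Section deriv_measurable.
Context (R : realType) (X : completeMetricType R).
Implicit Types (F : X -> R) (gam : fragment X).

Lemma frag_inj gam s t : dom gam s -> dom gam t -> gam s = gam t -> s = t.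
Proof.
have [c [C [c0 bl]]] := frag_bilip gam => ds dt est.
have /andP[+ _] := bl _ _ ds dt; rewrite est mdistxx pmulr_rle0// normr_le0.
by rewrite subr_eq0 => /eqP.
Qed.

Lemma deriv_along_quotient gam F t l e : is_deriv_along gam F t l -> 0 < e ->
  exists2 d, 0 < d & forall s, dom gam s -> s != t -> `|s - t| < d ->
    `|(F (gam s) - F (gam t)) / (s - t) - l| < e.
Proof.
move=> [dt _ Fl] e0.
have : \forall s \near within (dom gam) t^',
    `|l - (F (gam s) - F (gam t)) / (s - t)| < e.
  exact: (@cvgr_dist_lt _ R^o _ _ _ _ _ Fl).
move=> /nbhs_ballP[d /= d0 dP]; exists d => // s ds st sd.
by rewrite distrC; apply: dP => //; rewrite /ball/= distrC.
Qed.

Lemma deriv_along_limit gam F t l d : is_deriv_along gam F t l -> 0 < d ->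
  exists s, [/\ dom gam s, s != t & `|s - t| < d].
Proof.
move=> [_ lt _] d0.
have [s [st ds sd]] := lt _ (nbhsx_ballx t d d0).
by exists s; split => //; rewrite distrC.
Qed.

Lemma deriv_along_unique gam F t l1 l2 :
  is_deriv_along gam F t l1 -> is_deriv_along gam F t l2 -> l1 = l2.
Proof.
move=> h1 h2; apply/eqP; rewrite -subr_eq0 -normr_le0.
apply/ler_addgt0Pl => e e0; rewrite addr0.
have e20 : 0 < e / 2 by rewrite divr_gt0.
have [d1 d10 q1] := deriv_along_quotient h1 e20.
have [d2 d20 q2] := deriv_along_quotient h2 e20.
have [|s [ds st]] := @deriv_along_limit _ _ _ _ (Num.min d1 d2) h1.
  by rewrite lt_min d10.
rewrite lt_min => /andP[sd1 sd2].
rewrite (splitr e) -(subrKA ((F (gam s) - F (gam t)) / (s - t))).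
rewrite (le_trans (ler_normD _ _))// lerD// ltW//; last exact: q2.
by rewrite distrC; exact: q1.
Qed.

Lemma deriv_along_le gam F t l C L : is_deriv_along gam F t l ->
  frag_lipschitz C gam -> (forall x y, `|F x - F y| <= L * mdist x y) ->
  0 <= L -> `|l| <= L * C.
Proof.
move=> h gC FL L0; apply/ler_addgt0Pl => e e0.
have [d d0 q] := deriv_along_quotient h e0.
have [s [ds st sd]] := deriv_along_limit h d0.
have dt : dom gam t by case: h.
rewrite -(subrK ((F (gam s) - F (gam t)) / (s - t)) l).
rewrite (le_trans (ler_normD _ _))// lerD//.
  by rewrite distrC ltW//; exact: q.
rewrite normrM normfV ler_pdivrMr ?normr_gt0 ?subr_eq0//.
rewrite (le_trans (FL _ _))// -mulrA ler_wpM2l//; exact: gC.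
Qed.

Lemma closed_le_fun (T : topologicalType) (g h : T -> R) :
  continuous g -> continuous h -> closed [set z | g z <= h z].
Proof.
move=> cg ch.
rewrite (_ : [set z | _] = (fun z => g z - h z) @^-1` [set x | x <= 0]).
  apply: preimage_closed; last exact: closed_le.
  by move=> z _; apply: continuousB; [exact: cg|exact: ch].
by apply/seteqP; split => z /=; rewrite subr_le0.
Qed.

Lemma closed_eq_fun (T : topologicalType) (g h : T -> X) :
  continuous g -> continuous h -> closed [set z | g z = h z].
Proof.
move=> cg ch; rewrite -openC openE => z /= /eqP gh.
have := @metric_hausdorff _ X; rewrite open_hausdorff => /(_ _ _ gh).
move=> [[A B] /= [/set_mem Az /set_mem Bz] [oA oB AB]].
have nA : nbhs z (g @^-1` A) by apply: cg; exact: open_nbhs_nbhs.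
have nB : nbhs z (h @^-1` B) by apply: ch; exact: open_nbhs_nbhs.
apply: filterS (filterI nA nB) => y /= [Ay By] E.
suff /set0P/negP : A `&` B !=set0 by apply.
by exists (g y); split => //; rewrite E.
Qed.

(** Some difference quotient of F o gam at t = gam^-1 x, over a distance at
    most 1 / (n + 1), is at most a.  Multiplying by (s - t)^2 makes this a
    closed condition whatever the sign of s - t. *)
Definition low_slope F (a : R) n : set (fragment X * X) :=
  [set u | exists t s, [/\ dom u.1 t, u.1 t = u.2, dom u.1 s &
    [/\ s != t, `|s - t| <= n.+1%:R^-1 &
        (F (u.1 s) - F u.2) * (s - t) <= a * (s - t) ^+ 2]]].

(** The condition s != t is not closed, but it is the union over m of the
    closed conditions |s - t| >= 1 / (m + 1). *)
Lemma low_slope_measurable (gam0 : fragment X) F a n : separable X ->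
  continuous F ->
  measurable (low_slope F a n : set (borel (frag_at gam0) * borel X)%type).
Proof.
move=> sX cF.
pose Z m : set ((R * X) * (R * X) * X) :=
  [set z | z.1.2.2 = z.2] `&`
  ([set z | m.+1%:R^-1 <= `|z.1.1.1 - z.1.2.1|] `&`
  ([set z | `|z.1.1.1 - z.1.2.1| <= n.+1%:R^-1] `&`
   [set z | (F z.1.1.2 - F z.2) * (z.1.1.1 - z.1.2.1)
              <= a * (z.1.1.1 - z.1.2.1) ^+ 2])).
have -> : low_slope F a n = \bigcup_m [set u : fragment X * X | exists p r,
    [/\ graph u.1 p, graph u.1 r & Z m (p, r, u.2)]].
  apply/seteqP; split => [[g x]/= [t [s [dt tx ds [st sn q]]]]|
      [g x]/= [m _ /= [_ [_ [[s ds <-] [t dt <-]]]]]].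
    have st0 : 0 < `|s - t| by rewrite normr_gt0 subr_eq0.
    have [m _ /(_ m)/= h] := near_infty_natSinv_lt (PosNum st0).
    exists m => //; exists (s, g s), (t, g t).
    split; [by exists s|by exists t|].
    by split => //=; split; [apply/ltW/h => /=|].
  move=> [/= gtx [/= ms [/= sn q]]]; exists t, s; split => //; split => //.
  apply: contraTneq ms => ->; rewrite subrr normr0 -ltNge invr_gt0//.
apply: bigcupT_measurable => m; rewrite -[X in measurable X]setCK.
apply: measurableC; apply: open_frag_prod_measurable => //; rewrite openC.
apply: closed_frag_hits.
pose T := ((R * X) * (R * X) * X)%type.
have [c1 c2] : continuous (fun z : T => z.1) /\ continuous (fun z : T => z.2).
  by split=> z; [exact: cvg_fst|exact: cvg_snd].
have [c11 c12] : continuous (fun z : T => z.1.1) /\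
    continuous (fun z : T => z.1.2).
  by split=> z; apply: (@continuous_comp _ _ _ _ _ z (c1 z));
    [exact: cvg_fst|exact: cvg_snd].
have [c111 c112] : continuous (fun z : T => z.1.1.1) /\
    continuous (fun z : T => z.1.1.2).
  by split=> z; apply: (@continuous_comp _ _ _ _ _ z (c11 z));
    [exact: cvg_fst|exact: cvg_snd].
have [c121 c122] : continuous (fun z : T => z.1.2.1) /\
    continuous (fun z : T => z.1.2.2).
  by split=> z; apply: (@continuous_comp _ _ _ _ _ z (c12 z));
    [exact: cvg_fst|exact: cvg_snd].
have cs : continuous (fun z : T => z.1.1.1 - z.1.2.1).
  by move=> z; apply: cvgB; [exact: c111|exact: c121].
have cn : continuous (fun z : T => `|z.1.1.1 - z.1.2.1|).
  by move=> z; apply: (continuous_comp (cs z)); exact: norm_continuous.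
apply: closedI; first exact: closed_eq_fun.
apply: closedI; first by apply: closed_le_fun => // z; exact: cst_continuous.
apply: closedI; first by apply: closed_le_fun => // z; exact: cst_continuous.
apply: closed_le_fun => z.
  apply: cvgM; last exact: cs.
  apply: cvgB; [apply: (continuous_comp (c112 z))|
                apply: (continuous_comp (c2 z))]; exact: cF.
apply: cvgM; first exact: cvg_cst.
by apply: cvgM; exact: cs.
Qed.

End deriv_measurable.

(** * A jointly measurable version of the derivative *)

Section frag_deriv.
Context (R : realType) (X : completeMetricType R).
Implicit Types (F : X -> R) (gam : fragment X).

Definition clip (L a : R) := Num.max (- L) (Num.min L a).

Definition rat_enum (k : nat) : R := ratr (odflt 0%R (unpickle k : option rat)).

(** When the derivative l at t exists, membership of (gam, gam t) holds for
    a < l and fails for a > l; it is open to either answer when a = l. *)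
Definition steep F (a : R) : set (fragment X * X) :=
  ~` \bigcap_n low_slope F a n.

(** Equal to the k-th rational, clipped to [-L, L], on the pairs that are steep
    for it, and to - L elsewhere. *)
Definition lower_slope F L k (u : fragment X * X) : R :=
  - L + (clip L (rat_enum k) + L) * \1_(steep F (rat_enum k)) u.

(** The derivative as a supremum of countably many lower bounds.  Clipping
    makes it bounded everywhere, including at pairs without a derivative. *)
Definition frag_deriv F L (u : fragment X * X) : R :=
  fine (esups (fun k => (lower_slope F L k u)%:E) 0%N).

Lemma frag_deriv_measurable (gam0 : fragment X) F L : separable X ->
  continuous F ->
  measurable_fun setT (frag_deriv F L : borel (frag_at gam0) * borel X -> R).
Proof.
move=> sX cF.
apply: (@measurableT_comp _ _ _ _ _ _ (@fine R)) => //.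
apply: measurable_fun_esups => k; apply/measurable_EFinP.
apply: measurable_funD => //; apply: measurable_funM => //.
apply: measurable_indic; apply: measurableC.
by apply: bigcapT_measurable => n; exact: low_slope_measurable.
Qed.

Lemma lower_slope_le F L k u : 0 <= L -> - L <= lower_slope F L k u <= L.
Proof.
move=> L0; rewrite /lower_slope /clip indicE.
have LL : - L <= L by rewrite (@le_trans _ _ 0)// oppr_le0.
case: (_ \in _); rewrite ?mulr1 ?mulr0 ?addr0 ?lexx//.
rewrite addrC addrK le_max lexx/= ge_max LL/= ge_min lexx//.
Qed.

Lemma frag_deriv_bound F L u : 0 <= L -> `|frag_deriv F L u| <= L.
Proof.
move=> L0; rewrite /frag_deriv.
set S := esups _ _.
have SL : (S <= L%:E)%E.
  apply: ge_ereal_sup => _ [k _ <-]; rewrite lee_fin.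
  by have /andP[] := lower_slope_le F k u L0.
have LS : ((- L)%:E <= S)%E.
  apply: (@le_trans _ _ (lower_slope F L 0 u)%:E).
    by rewrite lee_fin; have /andP[] := lower_slope_le F 0 u L0.
  by apply: ereal_sup_ubound; exists 0%N.
have Sfin : S \is a fin_num.
  by rewrite fin_numE; apply/andP; split;
    [apply: contraTneq LS|apply: contraTneq SL] => ->.
by rewrite ler_norml -!lee_fin fineK// LS.
Qed.

Lemma steep_lt gam F t l a : is_deriv_along gam F t l -> a < l ->
  steep F a (gam, gam t).
Proof.
move=> h al; have la0 : 0 < l - a by rewrite subr_gt0.
have [d d0 q] := deriv_along_quotient h la0.
have [n _ /(_ n)/= nd] := near_infty_natSinv_lt (PosNum d0).
move=> /(_ n I)[t' [s [/= dt' tt' ds [st sn]]]].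
have dt : dom gam t by case: h.
rewrite (frag_inj dt' dt tt') in st sn *.
have {q} := q s ds st (le_lt_trans sn (nd (leqnn n))).
set Q := _ / _ => Ql; have aQ : a < Q.
  by move: Ql; rewrite ltr_distl opprB addrCA subrr addr0 => /andP[].
have w0 : s - t != 0 by rewrite subr_eq0.
have -> : F (gam s) - F (gam t) = Q * (s - t) by rewrite divfK.
by rewrite -mulrA -expr2 ler_pM2r ?exprn_even_gt0// leNgt aQ.
Qed.

Lemma steep_ge gam F t l a : is_deriv_along gam F t l ->
  steep F a (gam, gam t) -> a <= l.
Proof.
move=> h st; rewrite leNgt; apply/negP => la.
have la0 : 0 < a - l by rewrite subr_gt0.
have [d d0 q] := deriv_along_quotient h la0.
apply: st => n _.
have dt : dom gam t by case: h.
have n0 : 0 < n.+1%:R^-1 :> R by rewrite invr_gt0.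
have [|s [ds st]] := @deriv_along_limit _ _ _ _ _ _ (Num.min d n.+1%:R^-1) h.
  by rewrite lt_min d0.
rewrite lt_min => /andP[sd sn]; exists t, s; split => //; split => //=.
  exact: ltW.
have {q} := q s ds st sd.
set Q := _ / _ => Ql; have Qa : Q < a.
  by move: Ql; rewrite ltr_distl => /andP[_]; rewrite addrC subrK.
have w0 : s - t != 0 by rewrite subr_eq0.
have -> : F (gam s) - F (gam t) = Q * (s - t) by rewrite divfK.
by rewrite -mulrA -expr2 ler_pM2r ?exprn_even_gt0// ltW.
Qed.

Lemma frag_derivE gam F t l L : is_deriv_along gam F t l -> `|l| <= L ->
  frag_deriv F L (gam, gam t) = l.
Proof.
move=> h nlL; have L0 := le_trans (normr_ge0 l) nlL.
move: nlL; rewrite ler_norml => /andP[Ll lL].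
rewrite /frag_deriv.
suff -> : esups (fun k => (lower_slope F L k (gam, gam t))%:E) 0%N = l%:E by [].
apply/eqP; rewrite eq_le; apply/andP; split.
  apply: ge_ereal_sup => _ [k _ <-]; rewrite lee_fin /lower_slope indicE.
  have [/set_mem k1|_] := boolP (_ \in _); last by rewrite mulr0 addr0.
  rewrite mulr1 addrC addrK /clip ge_max Ll ge_min.
  by rewrite (steep_ge h k1) orbT.
apply/lee_subgt0Pr => e e0; rewrite -EFinB.
have /rat_in_itvoo[r] : l - e < l by rewrite ltrBlDr ltrDl.
rewrite in_itv/= => /andP[er rl].
apply: (@le_trans _ _ (lower_slope F L (pickle r) (gam, gam t))%:E); last first.
  by apply: ereal_sup_ubound; exists (pickle r).
rewrite lee_fin /lower_slope /rat_enum pickleK/= indicE.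
rewrite mem_set ?mulr1; last first.
  exact: steep_lt h rl.
rewrite [- L + _]addrC addrK /clip le_max le_min; apply/orP; right.
by rewrite (ltW er) andbT (le_trans _ lL)// gerBl ltW.
Qed.

End frag_deriv.

(** * Integrals of functions that are not measurable *)

Section integral_ae.
Context d (T : measurableType d) (R : realType).
Context (m : {measure set T -> \bar R}).
Import HBNNSimple.
Local Open Scope ereal_scope.

Let ge0_ae_integral_le (N : set T) (f g : T -> \bar R) :
  measurable N -> m N = 0 ->
  (forall x, 0 <= f x) -> (forall x, 0 <= g x) ->
  (forall x, ~ N x -> f x = g x) -> \int[m]_x f x <= \int[m]_x g x.
Proof.
move=> mN N0 f0 g0 fg; rewrite !ge0_integralTE//.
apply: ge_ereal_sup => _ [h /= hf <-].
have mNC : measurable (~` N) by exact: measurableC.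
pose h' := proj_nnsfun h mNC.
have -> : sintegral m h = sintegral m h'.
  have sE (k : {nnsfun T >-> R}) : sintegral m k = \int[m]_x (k x)%:E.
    by rewrite integral_nnsfun// patch_setT.
  rewrite !sE.
  apply: ge0_ae_eq_integral => //.
  - exact/measurable_EFinP.
  - exact/measurable_EFinP.
  - by move=> x _; rewrite lee_fin.
  - by move=> x _; rewrite lee_fin.
  exists N; split => // x /= xN; apply: contrapT => Nx; apply: xN => _.
  by rewrite /h' /= /mindic indicE mem_set ?mulr1.
apply: ereal_sup_ubound; exists h' => // x /=.
rewrite /mindic indicE; have [/set_mem Nx|_] := boolP (x \in _); last first.
  by rewrite mulr0.
by rewrite mulr1 -fg.
Qed.

(** The integral of any function is the difference of the lower integrals of
    its positive and negative parts.  A simple function below f becomes a simple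
    function below g, with the same integral, once it is set to zero on a null
    set containing the points where f and g differ. *)
Lemma ae_integral_nonmeasurable (f g : T -> \bar R) :
  {ae m, forall x, f x = g x} -> \int[m]_x f x = \int[m]_x g x.
Proof.
move=> [N [mN N0 fgN]].
have fg x : ~ N x -> f x = g x by move=> Nx; apply: contrapT => /fgN.
have le0 (f' g' : T -> \bar R) :
    (forall x, 0 <= f' x) -> (forall x, 0 <= g' x) ->
    (forall x, ~ N x -> f' x = g' x) -> \int[m]_x f' x = \int[m]_x g' x.
  move=> f0 g0 e; apply/eqP; rewrite eq_le.
  by apply/andP; split; apply: (ge0_ae_integral_le mN) => // x /e.
rewrite integralE [RHS]integralE; congr (_ - _); apply: le0 => // x /fg fgx.
  by rewrite !funeposE fgx.
by rewrite !funenegE fgx.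
Qed.

End integral_ae.

(** * Null sets along fragments *)

Section hausdorff_null.
Context (R : realType) (X : completeMetricType R).
Local Open Scope ereal_scope.

(** Each piece of a cover of total diameter e has diameter at most e, so the
    restriction on the mesh is automatic. *)
Lemma hausdorff1_eq0 (A : set X) :
  (forall e : R, (0 < e)%R -> exists2 E : (set X)^nat, A `<=` \bigcup_n E n &
    \sum_(0 <= n <oo) diam (E n) <= e%:E) -> hausdorff1 A = 0.
Proof.
have diam0 (E : set X) : 0 <= diam E by apply: ereal_sup_ubound; left.
move=> cov; apply/eqP; rewrite eq_le; apply/andP; split; last first.
  apply: (@le_trans _ _ (hausdorff1_pre 1 A)); last first.
    by apply: ereal_sup_ubound; exists 1%R => //=; exact: ltr01.
  by apply: le_ereal_inf_tmp => _ [E _ <-]; apply: nneseries_ge0 => n _ _.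
apply: ge_ereal_sup => _ [d /= d0 <-].
apply/lee_addgt0Pr => e e0; rewrite add0e.
have de0 : (0 < Num.min d e)%R by rewrite lt_min d0.
have [E AE Ee] := cov _ de0.
apply: (@le_trans _ _ (\sum_(0 <= n <oo) diam (E n))); last first.
  by apply: (le_trans Ee); rewrite lee_fin ge_min lexx orbT.
apply: ereal_inf_lbound; exists E => //; split => // n.
apply: (@le_trans _ _ (\sum_(0 <= n <oo) diam (E n))); last first.
  by apply: (le_trans Ee); rewrite lee_fin ge_min lexx.
by rewrite (@nneseriesD1 _ _ n xpredT)// leeDl// nneseries_ge0.
Qed.

Lemma diam_arc_le (gam : fragment X) (C a b : R) : (0 <= C)%R ->
  frag_lipschitz C gam ->
  diam (frag_map gam @` (dom gam `&` `[a, b])) <=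
  C%:E * wlength idfun `]a, b[%classic.
Proof.
move=> C0 gC; rewrite wlength_itv/=.
apply: ge_ereal_sup => _ [->|[[x y] /= [[s [ds +] <-] [t [dt +] <-]] <-]].
  case: ifPn => [|_]; rewrite ?mule0// lte_fin => ab.
  by rewrite -EFinB -EFinM lee_fin mulr_ge0// subr_ge0 ltW.
rewrite /= !in_itv/= => /andP[a1 b1] /andP[a2 b2].
have dC : (mdist (gam s) (gam t) <= C * (b - a))%R.
  rewrite (le_trans (gC _ _ ds dt))// ler_wpM2l// ler_norml.
  by apply/andP; split; lra.
rewrite lte_fin; case: ltP => ab; first by rewrite -EFinB -EFinM lee_fin.
by rewrite mule0 lee_fin (le_trans dC)// mulr_ge0_le0// subr_le0.
Qed.

Lemma hausdorff1_arc_cover (gam : fragment X) (C : R) (F : nat -> R * R) :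
  (0 <= C)%R -> frag_lipschitz C gam ->
  \sum_(0 <= k <oo)
    diam (frag_map gam @` (dom gam `&` `[(F k).1, (F k).2])) <=
  C%:E * \sum_(0 <= k <oo) wlength idfun `](F k).1, (F k).2[%classic.
Proof.
move=> C0 gC; rewrite -nneseriesZl; last by move=> k _; exact: wlength_ge0.
apply: lee_nneseries => k _; last exact: diam_arc_le.
by move=> _; apply: ereal_sup_ubound; left.
Qed.

Lemma frag_lipschitz_ex (gam : fragment X) :
  exists2 C : R, (0 <= C)%R & frag_lipschitz C gam.
Proof.
have [c [C [c0 bl]]] := frag_bilip gam; exists `|C|%R => // s t ds dt.
have /andP[_ /le_trans] := bl _ _ ds dt; apply.
by apply: ler_wpM2r => //; exact: ler_norm.
Qed.

Lemma compact_borel (K : set X) : compact K -> measurable (K : set (borel X)).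
Proof.
move=> /(compact_closed (@metric_hausdorff _ X)) cK.
rewrite -[K]setCK; apply: measurableC; apply: sub_sigma_algebra.
by rewrite openC.
Qed.

(** The image of a Borel set of times need not be treated directly: covers of
    the null set by countably many intervals are enlarged to closed intervals,
    whose images are compact arcs.  The union of the arcs of one cover is Borel,
    and the sum of their diameters is controlled by the length of the cover; B
    is the intersection of these unions over a sequence of finer covers. *)
Lemma frag_null_image (gam : fragment X) (N : set R) :
  lebesgue_measure.-negligible N -> exists B : set (borel X),
    [/\ measurable B, frag_map gam @` (dom gam `&` N) `<=` B &
      forall S, S `<=` B -> hausdorff1 S = 0].
Proof.
move=> [M [mM M0 NM]]; have [C C0 gC] := frag_lipschitz_ex gam.
have cov n : exists F : nat -> R * R,
    M `<=` \bigcup_k `](F k).1, (F k).2[%classic /\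
    \sum_(0 <= k <oo) wlength idfun `](F k).1, (F k).2[%classic <=
      (n.+1%:R^-1)%:E.
  have n0 : (0 < n.+1%:R^-1 :> R)%R by rewrite invr_gt0.
  have : ((wlength idfun)^* M)%mu = 0 by [].
  rewrite outer_measure_open_itv_cover => M0'.
  have [|_ [I_ [oI MI] <-]] := @lb_ereal_inf_adherent _
      [set \sum_(k <oo) wlength idfun (I_ k) | I_ in open_itv_cover M] _ n0.
    by rewrite M0'.
  rewrite M0' add0e => /ltW Ie.
  have [F FI] := choice oI; exists F; split.
    by move=> x /MI[k _ Ix]; exists k => //; rewrite -FI.
  by under eq_eseriesr do rewrite -FI.
have [F FP] := choice cov.
pose B n := \bigcup_k (frag_map gam @` (dom gam `&` `[(F n k).1, (F n k).2])).
exists (\bigcap_n B n); split.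
- apply: bigcapT_measurable => n; apply: bigcupT_measurable => k.
  by apply: compact_borel; exact: compact_arc.
- move=> _ [t [dt /NM Mt] <-] n _; have [/(_ _ Mt)[k _ /= tk] _] := FP n.
  by exists k => //; exists t => //; split => //; exact: subset_itv_oo_cc tk.
move=> S SB; apply: hausdorff1_eq0 => e e0.
have eC0 : (0 < e / (C + 1))%R by rewrite divr_gt0// ltr_wpDl.
have [n _ /(_ n)/= /(_ (leqnn _)) nP] := near_infty_natSinv_lt (PosNum eC0).
exists (fun k => frag_map gam @` (dom gam `&` `[(F n k).1, (F n k).2])).
  by move=> x /SB/(_ n I).
apply: (le_trans (hausdorff1_arc_cover _ C0 gC)).
apply: (@le_trans _ _ (C%:E * (n.+1%:R^-1)%:E)).
  by apply: lee_wpmul2l => //; have [] := FP n.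
rewrite -EFinM lee_fin (@le_trans _ _ ((C + 1) * (e / (C + 1)))%R)//.
  by apply: ler_pM => //; [rewrite lerDl|exact: ltW].
by rewrite mulrC divfK// gt_eqF// ltr_wpDl.
Qed.

End hausdorff_null.

(** * Alberti representations as kernels *)

Section alberti_kernel.
Import HBNNSimple.
Context (R : realType) (X : completeMetricType R).
Context (mu : {measure set (borel X) -> \bar R}) (A : alberti mu).
Local Open Scope ereal_scope.

Lemma frag_image_borel (gam : fragment X) :
  measurable (frag_image gam : set (borel X)).
Proof.
apply: compact_borel; apply: continuous_compact; last exact: dom_compact.
exact: frag_continuous.
Qed.

Lemma alb_nu_out (gam : fragment X) : alb_nu A gam (~` frag_image gam) = 0.
Proof.
apply: alb_nu_ac; first by apply: measurableC; exact: frag_image_borel.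
rewrite setICl; apply: hausdorff1_eq0 => e e0; exists (fun=> set0) => //.
rewrite eseries0 ?lee_fin ?ltW// => n _ _.
apply/eqP; rewrite eq_le; apply/andP; split; last first.
  by apply: ereal_sup_ubound => /=; left.
by apply: ge_ereal_sup => x [->|[p []]].
Qed.

Lemma alb_nu_ae (gam : fragment X) (Q : R -> Prop) :
  {ae lebesgue_measure, forall t : R, dom gam t -> Q t} ->
  {ae alb_nu A gam, forall x, exists t, [/\ dom gam t, gam t = x & Q t]}.
Proof.
move=> /(@frag_null_image _ _ gam)[B [mB imB B0]].
have mim : measurable (~` frag_image gam : set (borel X)).
  by apply: measurableC; exact: frag_image_borel.
exists (B `|` ~` frag_image gam); split.
- exact: measurableU.
- apply: null_set_setU => //; last exact: alb_nu_out.
  by apply: alb_nu_ac => //; apply: B0; exact: subIsetl.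
move=> x /= nx; have [[t dt tx]|] := pselect (frag_image gam x); last by right.
left; apply: imB; exists t => //; split => //= Qt.
by apply: nx; exists t; split => //; exact: Qt.
Qed.

(** The masses of the arcs over [-n, n] are measurable in gam by definition;
    for each gam these arcs are eventually the whole image, which carries
    nu_gam. *)
Lemma alb_nu_measurable (S : set (borel X)) : measurable S ->
  measurable_fun setT (fun gam : borel (frag_at (alb_pt A)) => alb_nu A gam S).
Proof.
move=> mS.
apply: (@emeasurable_fun_cvg _ _ _ _
  (fun n (gam : borel (frag_at (alb_pt A))) =>
    alb_nu A gam
      (S `&` frag_map gam @` (dom gam `&` `[(- n%:R)%R, n%:R])))).
  by move=> n; apply: alb_arc_borel => //; rewrite -subr_ge0 opprK addr_ge0.
move=> gam _.
have [M [_ bM]] := compact_bounded (@dom_compact _ _ gam).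
apply: cvg_near_cst; near=> n.
have -> : dom gam `&` `[(- n%:R)%R, n%:R] = dom gam.
  apply/setIidl => t; have /bM : (M < n%:R)%R by near: n; exact: nbhs_infty_gtr.
  by move=> /[apply] /= tM; rewrite in_itv/= -ler_norml.
rewrite -[frag_map gam @` _]/(frag_image gam).
rewrite [RHS](@measureDI _ _ _ (alb_nu A gam) _ (frag_image gam))//; last first.
  exact: frag_image_borel.
rewrite [X in _ = X + _](_ : _ = 0) ?add0e//.
apply: (@subset_measure0 _ _ _ (alb_nu A gam) _ (~` frag_image gam)) => //.
- by apply: measurableD => //; exact: frag_image_borel.
- by apply: measurableC; exact: frag_image_borel.
- exact: alb_nu_out.
Unshelve. all: by end_near. Qed.

Definition alb_kernel : borel (frag_at (alb_pt A)) ->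
  {measure set (borel X) -> \bar R} := fun gam => alb_nu A gam.

HB.instance Definition _ :=
  isKernel.Build _ _ _ _ R alb_kernel alb_nu_measurable.

(** The measures nu_gam are finite without a uniform bound; pointwise
    finiteness is enough for the sections of product sets. *)
Lemma alb_nu_integral_measurable
    (k : borel (frag_at (alb_pt A)) * borel X -> \bar R) :
  (forall u, 0 <= k u) -> measurable_fun setT k ->
  measurable_fun setT (fun gam : borel (frag_at (alb_pt A)) =>
    \int[alb_nu A gam]_x k (gam, x)).
Proof.
move=> k0 mk.
have mX S : measurable S -> measurable_fun setT
    (fun gam : borel (frag_at (alb_pt A)) => alb_nu A gam (xsection S gam)).
  move=> mS.
  have [|_] := @measurable_prod_subset_xsection_kernel _ _ _ _ _ alb_kernel
     setT measurableT _ S mS.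
    move=> gam; exists (fine (alb_nu A gam setT) + 1)%R => B mB.
    rewrite EFinD fineK ?fin_num_measure// /mrestr setIT/=.
    rewrite (@le_lt_trans _ _ (alb_nu A gam setT))// ?le_measure ?inE//.
    by rewrite lteDl// ?fin_num_measure.
  by under eq_fun do rewrite /mrestr setIT.
apply: (@measurable_fun_xsection_integral _ _ _ _ _ k (fun gam => alb_nu A gam)
  (nnsfun_approx measurableT mk)).
- by move=> a b ab; exact/nd_nnsfun_approx.
- by move=> z; exact/cvg_nnsfun_approx.
- by move=> n r; apply: mX.
Qed.

End alberti_kernel.

(** * Cones and their inner normals *)

Section dot_theory.
Context (R : realType) (q : nat).
Implicit Types u v w : 'rV[R]_q.

Lemma dotC u v : dot u v = dot v u.
Proof. by apply: eq_bigr => j _; rewrite mulrC. Qed.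

Lemma dotDl u v w : dot (u + v) w = dot u w + dot v w.
Proof. by rewrite -big_split; apply: eq_bigr => j _; rewrite mxE mulrDl. Qed.

Lemma dotZl a u w : dot (a *: u) w = a * dot u w.
Proof. by rewrite mulr_sumr; apply: eq_bigr => j _; rewrite mxE mulrA. Qed.

Lemma dotBl u v w : dot (u - v) w = dot u w - dot v w.
Proof. by rewrite dotDl -scaleN1r dotZl mulN1r. Qed.

Lemma dotBr u v w : dot w (u - v) = dot w u - dot w v.
Proof. by rewrite dotC dotBl !(dotC w). Qed.

Lemma dotZr a u w : dot u (a *: w) = a * dot u w.
Proof. by rewrite dotC dotZl dotC. Qed.

Lemma dot_ge0 u : 0 <= dot u u.
Proof. by apply: sumr_ge0 => j _; rewrite -expr2 sqr_ge0. Qed.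

Lemma enorm_ge0 u : 0 <= enorm u. Proof. exact: sqrtr_ge0. Qed.

Lemma enorm_sqr u : enorm u ^+ 2 = dot u u.
Proof. by rewrite sqr_sqrtr// dot_ge0. Qed.

Lemma enorm_eq0 u : enorm u = 0 -> u = 0.
Proof.
move=> u0; have /eqP := enorm_sqr u; rewrite u0 expr0n/= eq_sym.
rewrite psumr_eq0; last by move=> j _; rewrite -expr2 sqr_ge0.
move=> /allP h; apply/rowP => j; rewrite mxE; apply/eqP.
by have := h j (mem_index_enum _); rewrite mulf_eq0 orbb.
Qed.

Lemma coord_le_enorm u j : `|u 0 j| <= enorm u.
Proof.
rewrite -sqrtr_sqr ler_wsqrtr// /dot (bigD1 j)//= -expr2 lerDl.
by apply: sumr_ge0 => i _; rewrite -expr2 sqr_ge0.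
Qed.

Lemma dot_le_enorm u v : dot u v <= enorm u * enorm v.
Proof.
have [u0|u0] := eqVneq (enorm u) 0.
  by rewrite (enorm_eq0 u0) -(scale0r 0) dotZl mul0r mulr_ge0 ?enorm_ge0.
have [v0|v0] := eqVneq (enorm v) 0.
  by rewrite (enorm_eq0 v0) -(scale0r 0) dotZr mul0r mulr_ge0 ?enorm_ge0.
have up : 0 < enorm u by rewrite lt_neqAle eq_sym u0 enorm_ge0.
have vp : 0 < enorm v by rewrite lt_neqAle eq_sym v0 enorm_ge0.
have := dot_ge0 (enorm v *: u - enorm u *: v).
rewrite dotBl !dotBr !dotZl !dotZr -!enorm_sqr (dotC v u).
set a := enorm u in up *; set b := enorm v in vp *; set c := dot u v => h.
have : 0 <= (a * b) * (a * b - c) by lra.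
by rewrite pmulr_rge0 ?mulr_gt0// subr_ge0.
Qed.

Lemma cone_not0 w theta : ~ cone w theta 0.
Proof.
rewrite /cone/= (_ : dot w 0 = 0) ?mulr0 ?ltNge ?enorm_ge0//.
by apply: big1 => j _; rewrite mxE mulr0.
Qed.

(** The inner normal to the cone along the ray of its boundary whose component
    orthogonal to v has the direction of that of u.  If u is on the axis this
    component is zero and, as the inverse of 0 is 0, the vector is
    sin theta *: v, which still serves the purpose. *)
Definition cone_normal v (theta : R) u : 'rV[R]_q :=
  sin theta *: v -
  (cos theta / enorm (orth_proj v u)) *: orth_proj v u.

Lemma dot_orth_proj v u : enorm v = 1 -> dot (orth_proj v u) v = 0.
Proof.
by move=> v1; rewrite dotBl dotZl -enorm_sqr v1 expr1n mulr1 dotC subrr.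
Qed.

Lemma cone_normal_self v theta u : enorm v = 1 ->
  dot (cone_normal v theta u) u =
  sin theta * dot v u - cos theta * enorm (orth_proj v u).
Proof.
move=> v1; rewrite dotBl !dotZl; congr (_ - _).
have -> : dot (orth_proj v u) u = enorm (orth_proj v u) ^+ 2.
  rewrite enorm_sqr [in X in _ = dot _ X]/orth_proj dotBr dotZr.
  by rewrite dot_orth_proj// mulr0 subr0.
have [->|n0] := eqVneq (enorm (orth_proj v u)) 0.
  by rewrite expr0n/= !mulr0.
by rewrite expr2 mulrA divfK.
Qed.

(** By Cauchy-Schwarz the orthogonal component of w contributes at most its
    norm, whatever the direction of the orthogonal component of u. *)
Lemma cone_normal_gt0 v theta u w : enorm v = 1 -> 0 < cos theta ->
  cone v theta w -> 0 < dot (cone_normal v theta u) w.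
Proof.
move=> v1 c0; rewrite /cone/= => wC.
have {}wC : cos theta * enorm (orth_proj v w) < sin theta * dot v w.
  move: wC; rewrite /tan dotC -(ltr_pM2l c0); congr (_ < _).
  by rewrite !mulrA [_ * (sin _)]mulrC mulfK ?gt_eqF.
rewrite dotBl !dotZl subr_gt0; apply: le_lt_trans wC.
rewrite -mulrA ler_wpM2l ?(ltW c0)//.
have -> : dot (orth_proj v u) w = dot (orth_proj v u) (orth_proj v w).
  by rewrite [in RHS]/orth_proj dotBr dotZr dot_orth_proj// mulr0 subr0.
have [->|n0] := eqVneq (enorm (orth_proj v u)) 0.
  by rewrite invr0 mul0r enorm_ge0.
rewrite mulrC ler_pdivrMr; last by rewrite lt_neqAle eq_sym n0 enorm_ge0.
by rewrite [leRHS]mulrC dot_le_enorm.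
Qed.

Lemma cone_normalP v theta u : enorm v = 1 -> 0 < cos theta ->
  cone v theta u <-> 0 < dot (cone_normal v theta u) u.
Proof.
move=> v1 c0; split; first exact: cone_normal_gt0.
rewrite cone_normal_self// subr_gt0 /cone/= /tan dotC => h.
rewrite -(ltr_pM2l c0).
by rewrite !mulrA [_ * (sin _)]mulrC mulfK ?gt_eqF// dotC.
Qed.

Lemma cone_normal_le2 v theta u j : enorm v = 1 ->
  `|cone_normal v theta u 0 j| <= 2.
Proof.
move=> v1; rewrite !mxE (le_trans (ler_normB _ _))// -[2]/(1 + 1) lerD//.
  rewrite normrM mulr_ile1// ?ler_norml ?sin_geN1 ?sin_le1//.
  by rewrite -v1 -ler_norml coord_le_enorm.
rewrite -mulrA normrM mulr_ile1// ?normr_ge0 ?ler_norml ?cos_geN1 ?cos_le1//.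
rewrite -ler_norml normrM normfV (ger0_norm (enorm_ge0 _)) mulrC.
have [->|n0] := eqVneq (enorm (orth_proj v u)) 0.
  by rewrite invr0 mulr0.
rewrite ler_pdivrMr; last by rewrite lt_neqAle eq_sym n0 enorm_ge0.
by rewrite mul1r; have := coord_le_enorm (orth_proj v u) j; rewrite !mxE.
Qed.

End dot_theory.

(** * Measurability of the normals *)

Section measurable_rows.
Context d (T : measurableType d) (R : realType) (q : nat).

Lemma measurable_invr : measurable_fun setT (@GRing.inv R).
Proof.
have -> : [set: R] = [set x | x != 0] `|` [set 0].
  by apply/seteqP; split => // x _; have [->|] := eqVneq x 0; [right|left].
apply/measurable_funU;
  [by apply: open_measurable; apply: open_neq|exact: measurable_set1|].
split; last exact: measurable_fun_set1.
apply: open_continuous_measurable_fun; first exact: open_neq.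
move=> x /set_mem; exact: inv_continuous.
Qed.

Lemma measurable_dot (u v : T -> 'rV[R]_q) :
  (forall j, measurable_fun setT (fun x => u x 0 j)) ->
  (forall j, measurable_fun setT (fun x => v x 0 j)) ->
  measurable_fun setT (fun x => dot (u x) (v x)).
Proof.
by move=> mu mv; apply: measurable_sum => j; exact: measurable_funM.
Qed.

Lemma measurable_enorm (u : T -> 'rV[R]_q) :
  (forall j, measurable_fun setT (fun x => u x 0 j)) ->
  measurable_fun setT (fun x => enorm (u x)).
Proof.
move=> mu; apply: (@measurableT_comp _ _ _ _ _ _ (@Num.sqrt R)).
  exact: continuous_measurable_fun (@sqrt_continuous R).
exact: measurable_dot.
Qed.

Lemma measurable_cone_normal (v u : T -> 'rV[R]_q) (theta : T -> R) :
  (forall j, measurable_fun setT (fun x => v x 0 j)) ->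
  measurable_fun setT theta ->
  (forall j, measurable_fun setT (fun x => u x 0 j)) ->
  forall j,
    measurable_fun setT (fun x => cone_normal (v x) (theta x) (u x) 0 j).
Proof.
move=> mv mt mu j.
have mp i : measurable_fun setT (fun x => orth_proj (v x) (u x) 0 i).
  under eq_fun do rewrite !mxE.
  apply: measurable_funB => //; apply: measurable_funM => //.
  exact: measurable_dot.
have -> : (fun x => cone_normal (v x) (theta x) (u x) 0 j) = (fun x =>
    sin (theta x) * v x 0 j - cos (theta x) / enorm (orth_proj (v x) (u x)) *
      orth_proj (v x) (u x) 0 j).
  by apply/funext => x; rewrite /cone_normal !mxE.
apply: measurable_funB; apply: measurable_funM => //.
  apply: (@measurableT_comp _ _ _ _ _ _ (@sin R)) => //.
  exact: continuous_measurable_fun (@continuous_sin R).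
apply: measurable_funM.
  apply: (@measurableT_comp _ _ _ _ _ _ (@cos R)) => //.
  exact: continuous_measurable_fun (@continuous_cos R).
apply: (@measurableT_comp _ _ _ _ _ _ (@GRing.inv R)).
  exact: measurable_invr.
exact: measurable_enorm.
Qed.

End measurable_rows.

Lemma borel_coord (R : realType) (X : completeMetricType R) (q : nat)
    (v : X -> 'rV[R]_q) (j : 'I_q) :
  measurable_fun setT (v : borel X -> borel 'rV[R]_q) ->
  measurable_fun setT (fun x : borel X => v x 0 j).
Proof.
move=> mv.
have mc : measurable_fun setT (fun M : borel 'rV[R]_q => M 0 j).
  move=> mT; apply: (measurability _ (RGenOpens.measurableE R)) => //.
  move=> _ [_ [a [b ->] <-]]; rewrite setTI; apply: sub_sigma_algebra.
  have /continuousP := @coord_continuous R 1 q 0 j; apply.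
  exact: interval_open.
exact: measurableT_comp mc mv.
Qed.

(** * Integration against an Alberti representation *)

Section positivity.
Context d (T : measurableType d) (R : realType).
Context (m : {measure set T -> \bar R}).
Local Open Scope ereal_scope.

Lemma ae_notin_of_integral_le0 (K : set T) (S : T -> \bar R) :
  measurable_fun setT S -> {ae m, forall x, 0 <= S x} ->
  {ae m, forall x, K x -> 0 < S x} -> \int[m]_x S x <= 0 ->
  {ae m, forall x, ~ K x}.
Proof.
move=> mS S0 KS intS.
have /ae_eq_integral_abs S00 : \int[m]_x `|S x| = 0.
  apply/eqP; rewrite eq_le integral_ge0// andbT.
  rewrite (@ae_integral_nonmeasurable _ _ _ _ _ S)//.
  by apply: filterS S0 => x; exact: gee0_abs.
have {}S00 := S00 measurableT mS.
by apply: filterS2 S00 KS => x /(_ I) -> h /h; rewrite ltxx.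
Qed.

Lemma bounded_support_integrable (K : set T) (f : T -> R) (c : R) :
  measurable K -> m K < +oo -> measurable_fun setT f ->
  (forall x, `|f x| <= c * \1_K x)%R -> m.-integrable setT (EFin \o f).
Proof.
move=> mK Koo mf fK.
apply: (@le_integrable _ _ _ _ _ _ _ (fun x => (c * \1_K x)%:E)) => //.
- exact/measurable_EFinP.
- by move=> x _; rewrite lee_fin (le_trans (fK x))//; exact: ler_norm.
under eq_fun do rewrite EFinM.
apply: integrableZl => //; apply/integrableP; split.
  exact/measurable_EFinP.
under eq_integral do rewrite /= ger0_norm//.
by rewrite integral_indic// setIT.
Qed.

End positivity.

Section iterated_integral.
Context (R : realType) (X : completeMetricType R).
Context (mu : {measure set (borel X) -> \bar R}) (A : alberti mu).
Context (K : set (borel X)) (mK : measurable K) (Koo : (mu K < +oo)%E).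
Context (k : borel (frag_at (alb_pt A)) * borel X -> R) (c : R).
Hypothesis mk : measurable_fun setT k.
Hypothesis kK : forall u, `|k u| <= c * \1_K u.2.
Local Open Scope ereal_scope.

Lemma measurable_frag_section (gam : fragment X) :
  measurable_fun setT (fun x : borel X => k (gam, x)).
Proof.
by apply: (@measurableT_comp _ _ _ _ _ _ k) => //; exact: measurable_pair1.
Qed.

Lemma frag_section_integrable (gam : fragment X) :
  (alb_nu A gam).-integrable setT (fun x => (k (gam, x))%:E).
Proof.
apply: (bounded_support_integrable mK _ _ (fun x => kK (gam, x))).
  by rewrite -ge0_fin_numE// fin_num_measure.
exact: measurable_frag_section.
Qed.

Lemma iterated_integrable : (alb_P A).-integrable setT
  (fun gam => \int[alb_nu A gam]_x (k (gam, x))%:E).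
Proof.
have mint : measurable_fun setT (fun gam : borel (frag_at (alb_pt A)) =>
    \int[alb_nu A gam]_x (k (gam, x))%:E).
  rewrite (_ : (fun gam => _) = fun gam : borel (frag_at (alb_pt A)) =>
      \int[alb_nu A gam]_x (EFin \o k)^\+ (gam, x) -
      \int[alb_nu A gam]_x (EFin \o k)^\- (gam, x)); last first.
    apply/funext => gam; rewrite integralE; congr (_ - _);
      by apply: eq_integral => x _; rewrite ?funeposE ?funenegE.
  apply: emeasurable_funB; apply: alb_nu_integral_measurable => //.
    by apply: measurable_funepos; exact/measurable_EFinP.
  by apply: measurable_funeneg; exact/measurable_EFinP.
apply: (@le_integrable _ _ _ _ _ _ _
  (fun gam : borel (frag_at (alb_pt A)) => c%:E * alb_nu A gam K)) => //.
  move=> gam _.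
  apply: (@le_trans _ _ (\int[alb_nu A gam]_x (c * \1_K x)%:E)).
    apply: (le_trans (le_abse_integral _ _ _)) => //.
      by apply/measurable_EFinP; exact: measurable_frag_section.
    apply: ge0_le_integral => //.
    - apply: measurableT_comp => //; apply/measurable_EFinP.
      exact: measurable_frag_section.
    - by apply/measurable_EFinP; exact: measurable_funM.
    - by move=> x _; rewrite lee_fin; exact: kK (gam, x).
  under eq_integral do rewrite EFinM.
  rewrite integralZl//; last exact: integrable_indic.
  by rewrite integral_indic// setIT lee_abs.
apply: integrableZl => //; apply/integrableP; split.
  exact: alb_nu_measurable.
under eq_integral do rewrite gee0_abs//.
by rewrite -alb_mu.
Qed.

End iterated_integral.

(** * Localization and compact sets *)

Section local_derivative.
Context (R : realType) (X : completeMetricType R).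
Implicit Types (F G : X -> R) (gam : fragment X).

Lemma deriv_along_local gam F G (U : set X) t l : open U -> U (gam t) ->
  (forall x, U x -> F x = G x) ->
  is_deriv_along gam F t l -> is_deriv_along gam G t l.
Proof.
move=> oU Ut FG [dt lt Fl]; split => //; apply: cvg_trans Fl.
apply: near_eq_cvg.
have : \forall s \near within (dom gam) (nbhs t), U (gam s).
  have /subspace_continuousP/(_ t dt) := @frag_continuous _ _ gam.
  by apply; exact: open_nbhs_nbhs.
rewrite !near_withinE; apply: filterS => s Us _ ds.
by rewrite FG ?FG//; exact: Us.
Qed.

Lemma frag_partialE gam F t l : is_deriv_along gam F t l ->
  frag_partial gam F (gam t) = l.
Proof.
move=> h; apply: xget_unique; first by exists t.
move=> l' [t' tt' h'].
have t't : t' = t by apply: frag_inj tt'; [case: h'|case: h].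
by move: h'; rewrite t't => /deriv_along_unique; apply.
Qed.

Lemma radon_compact_lty (mu : {measure set (borel X) -> \bar R}) (K : set X) :
  locally_finite mu -> compact K -> (mu K < +oo)%E.
Proof.
move=> lf cK; have mK := compact_borel cK.
have /choice[U UP] : forall x, exists V : set X,
    open_nbhs x V /\ (mu V < +oo)%E.
  by move=> x; have [V] := lf x; exists V.
have : finite_subset_cover setT U K.
  move: cK; rewrite compact_cover; apply.
    by move=> x _; have [[]] := UP x.
  by move=> x Kx; exists x => //; have [[]] := UP x.
move=> [E _ KE].
have mU x : measurable (U x : set (borel X)).
  by apply: sub_sigma_algebra; have [[]] := UP x.
pose V (s : seq X) : set (borel X) := \big[setU/set0]_(i <- s) U i.
have [mV V_lty] :
    (forall s, measurable (V s)) /\ (forall s, (mu (V s) < +oo)%E).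
  split; elim=> [|x s ih]; rewrite /V ?big_nil ?big_cons ?measure0//.
    exact: measurableU.
  apply: (le_lt_trans (measureU2 _ (mU x) _)); first exact: bigsetU_measurable.
  by rewrite lte_add_pinfty//; have [] := UP x.
apply: le_lt_trans (V_lty (finmap.enum_fset E)); rewrite le_measure ?inE//.
by move: KE; rewrite /cover bigcup_fset.
Qed.

Lemma lipschitz_continuous_fun F : lipschitz_fun F -> continuous F.
Proof.
move=> [L FL] x; apply/cvgrPdist_lt => e e0.
have L1 : 0 < `|L| + 1 by rewrite ltr_wpDl.
apply/nbhs_ballP; exists (e / (`|L| + 1)) => /=; first by rewrite divr_gt0.
move=> y; rewrite ballEmdist/= ltr_pdivlMr// mulrC; apply: le_lt_trans.
rewrite (le_trans (FL _ _))// ler_wpM2r ?mdist_ge0//.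
by rewrite (le_trans (ler_norm _))// lerDl.
Qed.

End local_derivative.

Section ae_imply.
Context d (T : measurableType d) (R : realType).
Context (m : {measure set T -> \bar R}).

Lemma ae_imply (P Q : T -> Prop) : (forall x, P x -> Q x) ->
  {ae m, forall x, P x} -> {ae m, forall x, Q x}.
Proof. by move=> PQ; exact: filterS. Qed.

Lemma ae_imply2 (P P' Q : T -> Prop) : (forall x, P x -> P' x -> Q x) ->
  {ae m, forall x, P x} -> {ae m, forall x, P' x} -> {ae m, forall x, Q x}.
Proof. by move=> PQ; exact: filterS2. Qed.

End ae_imply.

Lemma inner_regular_null (R : realType) (X : completeMetricType R)
    (mu : {measure set (borel X) -> \bar R}) (E : set (borel X)) :
  inner_regular mu -> measurable E ->
  (forall K : set X, compact K -> K `<=` E -> mu K = 0%E) -> mu E = 0%E.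
Proof.
move=> ir mE E0; apply/eqP; rewrite eq_le measure_ge0 andbT (ir _ mE).
by apply: ge_ereal_sup => _ [K [cK KE] <-]; rewrite E0.
Qed.

(** * The cone condition for the derivation *)

Section core.
Context (R : realType) (X : completeMetricType R).
Context (X_separable : separable X).
Context (mu : {measure set (borel X) -> \bar R}) (mu_radon : radon mu).
Context (q : nat) (f : X -> 'rV[R]_q).
Context (A : alberti mu) (C : cone_field X q) (D : derivation mu).
Hypotheses (Alip : alberti_lipschitz A) (Adir : in_direction A f C).
Hypothesis (AD : associated_derivation A D).
Context (U : set X) (h : 'I_q -> X -> R).
Hypotheses (oU : open U) (lh : forall j, lipb (h j)).
Hypothesis (hf : forall j x, U x -> h j x = f x 0 j).

Let Dh (x : X) : 'rV[R]_q := \row_j D (h j) x.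

Let a (x : X) : 'rV[R]_q := cone_normal (axis C x) (angle C x) (Dh x).

Let cos_angle x : 0 < cos (angle C x).
Proof.
have /andP[a0 a1] := angle_bounds C x.
apply: cos_gt0_pihalf; rewrite a1 andbT (lt_trans _ a0)//.
by rewrite oppr_lt0 divr_gt0// pi_gt0.
Qed.

Let mDh j : measurable_fun setT (fun x : borel X => Dh x 0 j).
Proof. by under eq_fun do rewrite mxE; exact: measurable_funPT. Qed.

Let ma j : measurable_fun setT (fun x : borel X => a x 0 j).
Proof.
apply: (@measurable_cone_normal _ (borel X)) => //.
  by move=> i; apply: borel_coord; exact: axis_borel.
exact: angle_borel.
Qed.

Let ms : measurable_fun setT (fun x : borel X => dot (a x) (Dh x)).
Proof. exact: (@measurable_dot _ (borel X)). Qed.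

Let lip_bound : exists ell : 'I_q -> R, (forall j, 0 <= ell j) /\
  {ae alb_P A, forall gam : fragment X, forall j t l,
     is_deriv_along gam (h j) t l -> `|l| <= ell j}.
Proof.
have [Cc AC] := Alip.
have /choice[L LP] : forall j, exists L : R,
    forall x y, `|h j x - h j y| <= L * mdist x y.
  by move=> j; have [_] := lh j.
exists (fun j => `|L j| * `|Cc|); split; first by move=> j; rewrite mulr_ge0.
move: AC; apply: ae_imply => gam gC j t l dl.
apply: (deriv_along_le dl) => //.
  move=> s s' ds ds'; rewrite (le_trans (gC _ _ ds ds'))// ler_wpM2r//.
  exact: ler_norm.
move=> x y; rewrite (le_trans (LP _ _ _))// ler_wpM2r ?mdist_ge0//.
exact: ler_norm.
Qed.

Local Open Scope ereal_scope.

(** The sum over j of the defining formula of D, with weights 1_K a_j, equates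
    a nonpositive number with an iterated integral that is positive unless K is
    null for almost every nu_gam. *)
Lemma null_compact_of_normal_le0 (K : set X) (n : R) : compact K -> K `<=` U ->
  (forall x, K x -> (enorm (Dh x) <= n)%R) ->
  (forall x, K x -> (dot (a x) (Dh x) <= 0)%R) -> mu K = 0.
Proof.
move=> cK KU Kn Ks; have mK := compact_borel cK.
have Koo : mu K < +oo by apply: radon_compact_lty => //; case: mu_radon.
have [ell [ell0 ellP]] := lip_bound.
pose k j (u : borel (frag_at (alb_pt A)) * borel X) : R :=
  (\1_K u.2 * a u.2 0 j * frag_deriv (h j) (ell j) u)%R.
have hcont j : continuous (h j).
  by apply: lipschitz_continuous_fun; have [] := lh j.
have mk j : measurable_fun setT (k j).
  apply: measurable_funM; last exact: frag_deriv_measurable.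
  apply: measurable_funM.
    exact: (measurableT_comp (measurable_indic mK) measurable_snd).
  exact: (measurableT_comp (ma j) measurable_snd).
have a2 x j : (`|a x 0 j| <= 2)%R by apply: cone_normal_le2; exact: axis_unit.
have kK j u : (`|k j u| <= 2 * ell j * \1_K u.2)%R.
  rewrite /k indicE; have [_|_] := boolP (_ \in _); last first.
    by rewrite !mul0r normr0 mulr0.
  rewrite mul1r mulr1 normrM ler_pM//.
  exact: frag_deriv_bound.
(* Here w is the velocity of f o gam.  On the open set U, f and h agree, so
   the derivatives of the h j along gam are its coordinates. *)
have good : {ae alb_P A, forall gam : fragment X, {ae alb_nu A gam, forall x,
    K x -> exists2 w, cone_at C x w & forall j,
      frag_partial gam (h j) x = (w 0 j)%R /\
      frag_deriv (h j) (ell j) (gam, x) = (w 0 j)%R}}.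
  move: ellP Adir; apply: ae_imply2 => gam ellP /(@alb_nu_ae _ _ _ A gam) gdir.
  move: gdir; apply: ae_imply => _ [t [dt <- [w fw Cw]]] Kt; exists w => // j.
  have dh : is_deriv_along gam (h j) t (w 0 j)%R.
    by apply: (deriv_along_local oU (KU _ Kt) _ (fw j)) => x /hf.
  by rewrite (frag_partialE dh) (frag_derivE dh)//; exact: ellP dh.
pose g j (x : borel X) : R := (\1_K x * a x 0 j)%R.
have mg j : measurable_fun setT (g j).
  by apply: measurable_funM => //; exact: ma.
have gK j x : (`|g j x| <= 2 * \1_K x)%R.
  rewrite normrM ger0_norm// mulrC ler_wpM2r//; exact: a2.
have Dint j : \int[mu]_x (g j x * D (h j) x)%:E =
    \int[alb_P A]_gam \int[alb_nu A gam]_x (k j (gam, x))%:E.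
  rewrite AD//.
  - apply: ae_integral_nonmeasurable; move: good; apply: ae_imply => gam good.
    apply: ae_integral_nonmeasurable; move: good; apply: ae_imply => x good.
    rewrite /k /g /= indicE; have [/set_mem /good[w _ wE]|_] := boolP (_ \in _).
      by have [-> ->] := wE j.
    by rewrite !mul0r.
  - exists 2%R => x; rewrite (le_trans (gK j x))// indicE.
    by case: (_ \in _); rewrite ?mulr1 ?mulr0.
  - exact: bounded_support_integrable (gK j).
have sum_le0 : \sum_(j < q) \int[mu]_x (g j x * D (h j) x)%:E <= 0.
  have gDint j : mu.-integrable setT (fun x => (g j x * D (h j) x)%:E).
    have int := @bounded_support_integrable _ _ _ mu K
      (fun x => g j x * D (h j) x)%R (2 * n)%R.
    apply: int => //.
      by apply: measurable_funM => //; exact: measurable_funPT.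
    move=> x; rewrite /g indicE.
    have [/set_mem Kx|_] := boolP (_ \in _); last first.
      by rewrite !mul0r normr0 mulr0.
    rewrite mul1r mulr1 normrM ler_pM//.
    have := coord_le_enorm (Dh x) j; rewrite mxE => /le_trans; apply.
    exact: Kn.
  rewrite -integral_sum//.
  apply: (@le_trans _ _ (\int[mu]_x cst 0 x)); last by rewrite integral0.
  apply: le_integral => //; [|exact: integrable0|].
    exact: integrable_sum.
  move=> x _; rewrite sumEFin lee_fin /g indicE.
  have [/set_mem Kx|_] := boolP (_ \in _); last first.
    by rewrite big1// => j _; rewrite !mul0r.
  apply: le_trans (Ks _ Kx); rewrite le_eqVlt; apply/orP; left; apply/eqP.
  by apply: eq_bigr => j _; rewrite mul1r; congr (_ * _)%R; rewrite mxE.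
(* For almost every gam, the integral over K of <a, velocity of f o gam>. *)
pose Psi (gam : borel (frag_at (alb_pt A))) : \bar R :=
  \int[alb_nu A gam]_x (\sum_(j < q) (k j (gam, x))%:E).
have PsiE : Psi = fun gam : borel (frag_at (alb_pt A)) =>
    \sum_(j < q) \int[alb_nu A gam]_x (k j (gam, x))%:E.
  apply/funext => gam; rewrite /Psi integral_sum// => j.
  exact: frag_section_integrable (mk j) (kK j) gam.
have kint j := iterated_integrable mK Koo (mk j) (kK j).
have mPsi : measurable_fun setT Psi.
  rewrite PsiE; apply: emeasurable_sum => j.
  exact: measurable_int (kint j).
have PsiP : \int[alb_P A]_gam Psi gam <= 0.
  by rewrite PsiE integral_sum// -(eq_bigr _ (fun j _ => Dint j)).
have sumk (gam : borel (frag_at (alb_pt A))) x (w : 'rV[R]_q) :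
    (forall j, frag_deriv (h j) (ell j) (gam, x) = (w 0 j)%R) ->
    \sum_(j < q) (k j (gam, x))%:E = (\1_K x * dot (a x) w)%:E.
  move=> dw; rewrite sumEFin; congr EFin; rewrite /dot mulr_sumr.
  by apply: eq_bigr => j _; rewrite /k /= dw mulrA.
have Spos (gam : borel (frag_at (alb_pt A))) : {ae alb_nu A gam, forall x,
    K x -> exists2 w, cone_at C x w & forall j,
      frag_partial gam (h j) x = (w 0 j)%R /\
      frag_deriv (h j) (ell j) (gam, x) = (w 0 j)%R} ->
    {ae alb_nu A gam, forall x, 0 <= \sum_(j < q) (k j (gam, x))%:E} /\
    {ae alb_nu A gam, forall x, K x -> 0 < \sum_(j < q) (k j (gam, x))%:E}.
  move=> gd; have Kpos x (w : 'rV[R]_q) : cone_at C x w -> (0 < dot (a x) w)%R.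
    by apply: cone_normal_gt0 => //; exact: axis_unit.
  split; move: gd; apply: ae_imply => x gd; last first.
    move=> Kx; have [w Cw wE] := gd Kx.
    rewrite (sumk _ _ w); last by move=> j; have [] := wE j.
    by rewrite indicE mem_set// mul1r lte_fin Kpos.
  have [Kx|Kx] := pselect (K x).
    have [w Cw wE] := gd Kx.
    rewrite (sumk _ _ w); last by move=> j; have [] := wE j.
    by rewrite lee_fin mulr_ge0// ltW// Kpos.
  apply: sume_ge0 => j _; rewrite /k/= indicE memNset// !mul0r//.
have Psi0 : {ae alb_P A, forall gam, 0 <= Psi gam}.
  move: good; apply: ae_imply => gam /Spos[S0 _].
  rewrite /Psi (@ae_integral_nonmeasurable _ _ _ _ _ (fun x =>
    `|\sum_(j < q) (k j (gam, x))%:E|)); first by apply: integral_ge0.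
  by move: S0; apply: ae_imply => x /gee0_abs.
have Psi1 : {ae alb_P A, forall gam, alb_nu A gam K != 0 -> 0 < Psi gam}.
  move: good; apply: ae_imply => gam /Spos[S0 S1].
  apply: contraNlt => Psile.
  suff : {ae alb_nu A gam, forall x, ~ K x}.
    move=> [N [mN N0 KN]]; apply/eqP; apply: (subset_measure0 mK mN) N0.
    by move=> x Kx; apply: KN => /=; exact.
  apply: (ae_notin_of_integral_le0 _ S0 S1 Psile).
  apply: emeasurable_sum => j; apply/measurable_EFinP.
  exact: measurable_frag_section.
have nu0 := ae_notin_of_integral_le0 mPsi Psi0 Psi1 PsiP.
rewrite (alb_mu A mK).
rewrite (@ae_integral_nonmeasurable _ _ _ _ _ (cst 0)) ?integral0//.
by move: nu0; apply: ae_imply => gam /negP; rewrite negbK => /eqP.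
Qed.

(** The exceptional set is exhausted by Borel sets B n on which D h is bounded,
    and these are null since their compact subsets are. *)
Lemma derivation_in_cone : {ae mu, forall x, U x -> cone_at C x (Dh x)}.
Proof.
pose B (n : nat) : set (borel X) := U `&`
  ([set x | dot (a x) (Dh x) <= 0]%R `&` [set x | enorm (Dh x) <= n%:R]%R).
have mB n : measurable (B n).
  apply: measurableI; first exact: sub_sigma_algebra.
  have mle (g : borel X -> R) (c : R) : measurable_fun setT g ->
      measurable [set x | (g x <= c)%R].
    move=> mg; rewrite -[X in measurable X]setTI.
    rewrite (_ : [set x | _] = g @^-1` `]-oo, c]); first exact: mg.
    by apply/seteqP; split => x /=; rewrite in_itv.
  by apply: measurableI; apply: mle => //;
    exact: (@measurable_enorm _ (borel X)).
have B0 n : mu (B n) = 0.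
  apply: inner_regular_null; [by case: mu_radon|exact: mB|move=> K cK KB].
  apply: (@null_compact_of_normal_le0 K n%:R%R) => // x /KB; first by case.
    by case=> _ [].
  by case=> _ [].
have : mu.-negligible (\bigcup_n B n).
  by apply: negligible_bigcup => n; apply/negligibleP; [exact: mB|exact: B0].
apply: negligibleS => x /= /not_implyP[Ux xC].
exists (Num.truncn (enorm (Dh x))).+1 => //; split => //; split => /=.
  rewrite leNgt; apply/negP => s0; apply: xC.
  by apply/cone_normalP => //; exact: axis_unit.
by apply/ltW; exact: Num.Theory.truncnS_gt.
Qed.

End core.

(** * Truncation, and the theorem *)

Section truncation.
Context (R : realType) (X : completeMetricType R) (q : nat).
Context (f : X -> 'rV[R]_q) (f_lipschitz : lipschitz_vec f).

Lemma clip_id (c y : R) : `|y| <= c -> clip c y = y.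
Proof.
by rewrite ler_norml /clip => /andP[cy yc]; rewrite (min_idPr yc) (max_idPr cy).
Qed.

Lemma clip_lipb (F : X -> R) (c : R) : lipschitz_fun F ->
  lipb (fun x => clip c (F x)).
Proof.
move=> [L FL]; split.
  exists `|c| => x; rewrite ler_norml /clip le_max ge_max ge_min.
  have cN : - c <= `|c| by rewrite -normrN ler_norm.
  by rewrite lerN2 ler_norm cN.
exists L => x y; apply: le_trans (FL x y); rewrite /clip.
have := ler_norm (F x - F y); have := ler_norm (F y - F x).
rewrite distrC; move: `|F x - F y| (F x) (F y) => d r s.
rewrite ler_norml; case: (leP c r) => ?; case: (leP c s) => ?;
  case: (leP (- c) c) => ?; case: (leP (- c) r) => ?; case: (leP (- c) s) => ?;
  by move=> ? ?; apply/andP; split; lra.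
Qed.

(** On the ball of radius n around the base point, a coordinate of f differs
    from its value at the base point by at most |L| n, hence clipping at
    |f point 0 j| + |L| n does not change it. *)
Lemma local_truncation : exists h : nat -> 'I_q -> X -> R,
  (forall n j, lipb (h n j)) /\
  forall n j x, ball point n%:R x -> h n j x = f x 0 j.
Proof.
have [L fL] := f_lipschitz.
have jL j x y : `|f x 0 j - f y 0 j| <= L * mdist x y.
  apply: le_trans (fL x y).
  by have := coord_le_enorm (f x - f y) j; rewrite !mxE.
exists (fun n j x => clip (`|f point 0 j| + `|L| * n%:R) (f x 0 j)).
split=> [n j|n j x]; first by apply: clip_lipb; exists L.
rewrite ballEmdist/= => xn; apply: clip_id.
rewrite -[f x 0 j](subrK (f point 0 j)) addrC (le_trans (ler_normD _ _))//.
rewrite lerD2l (le_trans (jL _ _ _))//.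
apply: (@le_trans _ _ (`|L| * mdist x point)).
  by rewrite ler_wpM2r ?mdist_ge0// ler_norm.
by rewrite ler_wpM2l// metric_sym ltW.
Qed.

End truncation.

Lemma ball_exhaust (R : realType) (X : completeMetricType R) (x : X) :
  exists n : nat, ball point (n%:R : R) x.
Proof.
exists (Num.truncn (mdist point x)).+1; rewrite ballEmdist/=.
exact: Num.Theory.truncnS_gt.
Qed.

Theorem theorem3p24 (R : realType) (X : completeMetricType R)
    (X_separable : separable X)
    (mu : {measure set (borel X) -> \bar R}) (mu_radon : radon mu)
    (q : nat) (f : X -> 'rV[R]_q) (f_lipschitz : lipschitz_vec f) :
  (forall (A : alberti mu) (C : cone_field X q),
     alberti_lipschitz A -> in_direction A f C ->
     forall D : derivation mu, associated_derivation A D ->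
     forall Df : X -> 'rV[R]_q, extended_value_vec D f Df ->
     {ae mu, forall x, cone_at C x (Df x)}) /\
  (forall (k : nat) (A : 'I_k -> alberti mu) (C : 'I_k -> cone_field X q),
     (forall i, alberti_lipschitz (A i)) ->
     (forall i, in_direction (A i) f (C i)) ->
     independent_cone_fields C ->
     forall D : 'I_k -> derivation mu,
     (forall i, associated_derivation (A i) (D i)) ->
     independent_derivations D).
Proof.
have [h [lh hf]] := local_truncation f_lipschitz.
have main (A : alberti mu) (C : cone_field X q) (D : derivation mu) :
    alberti_lipschitz A -> in_direction A f C -> associated_derivation A D ->
    {ae mu, forall x, forall n, ball point n%:R x ->
      cone_at C x (\row_j D (h n j) x)}.
  move=> Alip Adir AD; apply/ae_foralln => n.
  by apply: (derivation_in_cone X_separable mu_radon Alip Adir AD) => //;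
    [exact: metric_ball_open|move=> j x; exact: hf].
split=> [A C Alip Adir D AD Df DfE|k A C Alip Adir Cind D AD lam lamD i].
  have DfD : {ae mu, forall x, forall n j, ball point n%:R x ->
      Df x 0 j = D (h n j) x}.
    apply/ae_foralln => n; apply: filter_forall => j.
    have [mDf DfK] := DfE j.
    (* The extended value is prescribed on compact sets only; inner regularity
       of mu gives the equality almost everywhere on the ball. *)
    pose E : set (borel X) := ball point n%:R `&`
      [set x | Df x 0 j - D (h n j) x != 0].
    have mE : measurable E.
      apply: measurableI.
        by apply: sub_sigma_algebra; exact: metric_ball_open.
      rewrite -[X in measurable X]setTI.
      apply: (@measurable_funB _ _ _ _ _ _ mDf (measurable_funPT (D (h n j)))
        measurableT [set y | y != 0]).
      by apply: open_measurable; exact: open_neq.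
    have E0 : mu E = 0%E.
      apply: inner_regular_null => //; first by case: mu_radon.
      move=> K cK KE; have mK := compact_borel cK.
      have := DfK K (h n j) cK (lh n j).
      have KhE : forall x, K x -> h n j x = f x 0 j.
        by move=> x /KE[bx _]; exact: hf.
      move=> /(_ KhE)[N [mN N0 KN]]; apply: (subset_measure0 mK mN) N0 => x Kx.
      apply: KN => /= /(_ Kx) e; have [_ /=] := KE _ Kx.
      by rewrite e subrr eqxx.
    exists E; split => // x /= /not_implyP[bx Dx]; split => //=.
    by rewrite subr_eq0; apply/eqP.
  move: (main A C D Alip Adir AD) DfD; apply: ae_imply2 => x xC xD.
  have [n xn] := ball_exhaust x.
  have -> : Df x = \row_j D (h n j) x.
    by apply/rowP => j; rewrite mxE; exact: xD.
  exact: xC.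
have cones : {ae mu, forall x, forall i n, ball point n%:R x ->
    cone_at (C i) x (\row_j D i (h n j) x)}.
  by apply: filter_forall => i'; exact: main (Alip i') (Adir i') (AD i').
have sums : {ae mu, forall x, forall n j,
    \sum_(i < k) lam i x * D i (h n j) x = 0}.
  apply/ae_foralln => n; apply: filter_forall => j.
  by move: (lamD _ (lh n j)); apply: ae_imply => x; apply.
move: cones sums; apply: ae_imply2 => x xC xS _.
have [n xn] := ball_exhaust x.
(* A vector of the cone is nonzero, as the inequality defining it is strict. *)
have /freeP fr : free [tuple \row_j D i (h n j) x | i < k].
  apply: Cind => i'; split; first exact: xC.
  by apply/eqP => u0; have := xC i' n xn; rewrite u0; exact: cone_not0.
apply: (fr (fun i => lam i x)); apply/rowP => j.
rewrite summxE mxE -[RHS](xS n j).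
apply: eq_bigr => i' _; rewrite mxE; congr (_ * _).
by rewrite -tnth_nth tnth_mktuple mxE.
Qed.
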